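(* Let $m,n\ge1$ be integers, let $1<p_1,\dots,p_m<\infty$ and let $p$ be defined by $\frac1p=\frac1{p_1}+\cdots+\frac1{p_m}$. Then there is a constant $c>0$, depending only on $n,m,p_1,\dots,p_m$, such that the following holds. Let $\mu$ be a Borel measure on $\mathbb{R}^{n+1}_+$ and let $\overrightarrow{w}=(w_1,\dots,w_m)$ be weights on $\mathbb{R}^n$ such that $\overrightarrow{w}$ satisfies the multilinear $A_{\overrightarrow{P}}$ condition and $(\mu,v_{\overrightarrow{w}})$ satisfies the $C_\infty$ condition, where $v_{\overrightarrow{w}}=\prod_{i=1}^m w_i^{p/p_i}$. Then for all $f_i\in L^{p_i}(\mathbb{R}^n,w_i)$, $i=1,\dots,m$, $$\|\mathfrak{M}(\overrightarrow{f})\|_{L^p(\mathbb{R}^{n+1}_+,\mu)}\le c\,[\mu,v_{\overrightarrow{w}}]_{C_\infty}^{1/p}\,[\overrightarrow{w}]_{A_{\overrightarrow{P}}}^{\bar p}\prod_{i=1}^m\|f_i\|_{L^{p_i}(\mathbb{R}^n,w_i)},$$ where $\bar p=\max\{p_1',\dots,p_m'\}$.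
   Context: A weight on $\mathbb{R}^n$ is a nonnegative locally integrable function. $\|f\|_{L^{q}(\mathbb{R}^n,w)}=(\int_{\mathbb{R}^n}|f|^q w\,dx)^{1/q}$. All cubes $Q\subset\mathbb{R}^n$ have sides parallel to the coordinate axes, $|Q|$ is Lebesgue measure, $l(Q)$ is the side length. $p_i'=p_i/(p_i-1)$. $\mathbb{R}^{n+1}_+=\{(x,t):x\in\mathbb{R}^n,\ t\ge0\}$, and for a cube $Q\subset\mathbb{R}^n$, $\widetilde{Q}=\{(x,t)\in\mathbb{R}^{n+1}_+:x\in Q,\ 0\le t<l(Q)\}$. The multilinear maximal operator on the upper half-space is, for $\overrightarrow{f}=(f_1,\dots,f_m)$, $$\mathfrak{M}(\overrightarrow{f})(x,t)=\sup_{Q\ni x,\ l(Q)\ge t}\ \prod_{i=1}^m\frac1{|Q|}\int_Q|f_i(y_i)|\,dy_i,$$ the supremum being over cubes $Q\subset\mathbb{R}^n$ with $x\in Q$ and $l(Q)\ge t$. $\overrightarrow{w}$ satisfies the multilinear $A_{\overrightarrow{P}}$ condition if $$[\overrightarrow{w}]_{A_{\overrightarrow{P}}}=\sup_Q\left(\frac1{|Q|}\int_Q v_{\overrightarrow{w}}(x)\,dx\right)^{1/p}\prod_{i=1}^m\left(\frac1{|Q|}\int_Q w_i^{1-p_i'}(x)\,dx\right)^{1/p_i'}<\infty.$$ For a weight $v$ on $\mathbb{R}^n$, $(\mu,v)$ satisfies the $C_\infty$ condition if $$[\mu,v]_{C_\infty}=\sup_Q\mu(\widetilde{Q})\left(\int_Q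 v(x)\,dx\right)^{-1}<\infty.$$ Both suprema are over all cubes $Q$ in $\mathbb{R}^n$. *)

(* Defs.v *)
From HB Require Import structures.
From mathcomp Require Import all_boot all_order all_algebra.
From mathcomp Require Import all_classical all_reals all_analysis.

Set Implicit Arguments.
Unset Strict Implicit.
Unset Printing Implicit Defensive.
Import Order.TTheory GRing.Theory Num.Theory.
Import numFieldNormedType.Exports.

Local Open Scope classical_set_scope.
Local Open Scope ring_scope.
Local Open Scope ereal_scope.

(* R^n is [n.-tuple R]; its canonical sigma-algebra, generated by the
   coordinate maps, is the Borel one. *)

Section lebesgue_measure_Rn.
Context {R : realType}.

Definition tcons n (z : measurableTypeR R * n.-tuple R) : n.+1.-tuple R :=
  [the n.+1.-tuple R of z.1 :: z.2].

Fixpoint lebesgue_measure_Rn (n : nat) : set (n.-tuple R) -> \bar R :=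
  match n with
  | 0%N => \d_ [tuple]
  | k.+1 => pushforward (lebesgue_measure \x @lebesgue_measure_Rn k) (@tcons k)
  end.

Lemma measurable_tcons n :
  measurable_fun [set: measurableTypeR R * n.-tuple R] (@tcons n).
Proof.
apply: (@measurable_cons _ _ (measurableTypeR R * n.-tuple R)%type R fst n snd).
  exact: measurable_fst.
exact: measurable_snd.
Qed.

Definition box n (A : 'I_n -> set R) : set (n.-tuple R) :=
  [set x | forall i, A i (tnth x i)].

Lemma measurable_box n (A : 'I_n -> set R) :
  (forall i, measurable (A i)) -> measurable (box A).
Proof.
move=> mA.
rewrite (_ : box A = \bigcap_(i in [set: 'I_n]) ((@tnth n R ^~ i) @^-1` A i)).
  apply: fin_bigcap_measurable; first exact: finite_finset.
  move=> i _; rewrite -[X in measurable X]setTI; exact: measurable_tnth.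
by apply/seteqP; split => [x Ax i _|x Ax i]; exact: Ax.
Qed.

Let lebesgue_measure_Rn_spec n :
  exists2 m : {sigma_finite_measure set (n.-tuple R) -> \bar R},
    lebesgue_measure_Rn (n := n) = m :> (set (n.-tuple R) -> \bar R) &
    forall A : 'I_n -> set R, (forall i, measurable (A i)) ->
      m (box A) = \prod_(i < n) lebesgue_measure (A i).
Proof.
elim: n => [|n [m mE mbox]].
  exists (\d_ [tuple] : {sigma_finite_measure set (0.-tuple R) -> \bar R}) => //.
  by move=> A _; rewrite big_ord0 /= diracE mem_set // => -[].
pose M : {measure set (n.+1.-tuple R) -> \bar R} :=
  measure_function_pushforward__canonical__measure_function_Measure
    (lebesgue_measure \x m) (@measurable_tcons n).
have Mbox (A : 'I_n.+1 -> set R) : (forall i, measurable (A i)) ->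
    M (box A) = \prod_(i < n.+1) lebesgue_measure (A i).
  move=> mA; rewrite big_ord_recl -mbox//.
  rewrite -(product_measure1E lebesgue_measure m);
    [|exact: mA|exact: measurable_box].
  rewrite /M /= /pushforward; congr product_measure1.
  apply/seteqP; split => [[x y] /= xyA|[x y] /= [xA yA] i].
  - split; first by have := xyA ord0.
    by move=> i; have := xyA (lift ord0 i); rewrite tnthS.
  - by case: (unliftP ord0 i) => [j|] -> //; rewrite tnthS; exact: yA.
have Msf : sigma_finite setT M.
  exists (fun k => box (fun _ : 'I_n.+1 => `[(- k%:R)%R, k%:R%R]%classic : set R)).
    apply/esym; rewrite -subTset => x _.
    exists (\max_(i < n.+1) (Num.truncn `|tnth x i|%R).+1)%N => // i.
    rewrite /= in_itv /= -ler_norml.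
    apply: (@le_trans _ _ ((Num.truncn `|tnth x i|%R).+1)%:R%R).
      by apply/ltW/truncnS_gt.
    by rewrite ler_nat (leq_bigmax i).
  move=> k; split; first exact: measurable_box.
  rewrite Mbox// ltey_eq prode_fin_num// => i _.
  by rewrite lebesgue_measure_itv; case: ifPn.
pose MS : {sigma_finite_measure set (n.+1.-tuple R) -> \bar R} :=
  HB.pack (Measure.sort M) (Measure.class M)
    (Measure_isSigmaFinite.Build _ _ _ M Msf).
exists MS; last exact: Mbox.
by rewrite /MS /= mE.
Qed.

Let lebesgue_measure_Rn0 n : lebesgue_measure_Rn (n := n) set0 = 0.
Proof. by have [m -> _] := lebesgue_measure_Rn_spec n. Qed.

Let lebesgue_measure_Rn_ge0 n A : 0 <= lebesgue_measure_Rn (n := n) A.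
Proof. by have [m -> _] := lebesgue_measure_Rn_spec n. Qed.

Let lebesgue_measure_Rn_sigma_additive n :
  semi_sigma_additive (lebesgue_measure_Rn (n := n)).
Proof.
by have [m -> _] := lebesgue_measure_Rn_spec n; exact: measure_semi_sigma_additive.
Qed.

HB.instance Definition _ n := isMeasure.Build _ _ _
  (lebesgue_measure_Rn (n := n)) (lebesgue_measure_Rn0 n)
  (@lebesgue_measure_Rn_ge0 n) (@lebesgue_measure_Rn_sigma_additive n).

Let lebesgue_measure_Rn_sigma_finite n :
  sigma_finite setT (lebesgue_measure_Rn (n := n)).
Proof.
by have [m -> _] := lebesgue_measure_Rn_spec n; exact: sigma_finiteT.
Qed.

HB.instance Definition _ n := Measure_isSigmaFinite.Build _ _ _
  (lebesgue_measure_Rn (n := n)) (@lebesgue_measure_Rn_sigma_finite n).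

Lemma lebesgue_measure_Rn_box n (A : 'I_n -> set R) :
  (forall i, measurable (A i)) ->
  lebesgue_measure_Rn (box A) = \prod_(i < n) lebesgue_measure (A i).
Proof. by have [m -> mbox] := lebesgue_measure_Rn_spec n; exact: mbox. Qed.

End lebesgue_measure_Rn.

Arguments lebesgue_measure_Rn {R n}.
Local Notation lebRn := lebesgue_measure_Rn.

(* Measurability with respect to the completion of Lebesgue measure on R^n.
   As the integral of a nonnegative function is the supremum of the integrals
   of the simple functions below it, [\int[lebRn]] has its usual value on
   functions that are measurable in this sense. *)
Definition lebesgue_measurable (R : realType) n (f : n.-tuple R -> R) :=
  exists2 g : n.-tuple R -> R, measurable_fun [set: n.-tuple R] g &
    {ae lebRn, forall x, f x = g x}.

(* The cube with lowest corner [corner Q]; its side length is positive. *)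
Record cube (R : realType) n := Cube {
  corner : n.-tuple R;
  side : {posnum R} }.

Section maximal_operator.
Context {R : realType} {n : nat}.
Implicit Types (Q : cube R n) (x : n.-tuple R) (t : R).

Definition cube_set Q : set (n.-tuple R) :=
  [set x | forall i,
    (tnth (corner Q) i <= tnth x i <= tnth (corner Q) i + (side Q)%:num)%R].

Definition average Q (g : n.-tuple R -> \bar R) : \bar R :=
  (\int[lebRn]_(x in cube_set Q) g x) / lebRn (cube_set Q).

(* R^{n+1}_+ as a Borel subset of R^n x R. *)
Definition upper_half_space : set (n.-tuple R * R) := [set z | (0 <= z.2)%R].

Definition tent Q : set (n.-tuple R * R) :=
  [set z | cube_set Q z.1 /\ (0 <= z.2 < (side Q)%:num)%R].

Definition weight (w : n.-tuple R -> R) :=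
  [/\ forall x, (0 <= w x)%R, lebesgue_measurable w &
      forall Q, \int[lebRn]_(x in cube_set Q) (w x)%:E < +oo].

(* The power [a `^ r] with the convention 0 `^ r = +oo for r < 0 ([powR] has
   value 0 there). *)
Definition powRy (a r : R) : \bar R :=
  if (a == 0%R) && (r < 0)%R then +oo else (powR a r)%:E.

Definition weighted_norm (q : R) (w f : n.-tuple R -> R) : \bar R :=
  poweR (\int[lebRn]_x (powR `|f x| q * w x)%R%:E) q^-1%R.

Definition weighted_Lspace (q : R) (w f : n.-tuple R -> R) :=
  lebesgue_measurable f /\ weighted_norm q w f < +oo.

Context {m : nat}.
Implicit Types (f w : 'I_m -> n.-tuple R -> R) (P : 'I_m -> R).

Definition multilinear_maximal f (z : n.-tuple R * R) : \bar R :=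
  ereal_sup [set \prod_(i < m) average Q (fun y => `|f i y|%R%:E) |
             Q in [set Q | cube_set Q z.1 /\ (z.2 <= (side Q)%:num)%R]].

Definition conjugate (q : R) : R := (q / (q - 1))%R.

Definition v_weight (p : R) P w (x : n.-tuple R) : R :=
  (\prod_(i < m) powR (w i x) (p / P i))%R.

Definition A_constant (p : R) P w : \bar R :=
  ereal_sup (range (fun Q : cube R n =>
    poweR (average Q (fun x => (v_weight p P w x)%:E)) p^-1%R *
    \prod_(i < m)
      poweR (average Q (fun x => powRy (w i x) (1 - conjugate (P i))%R))
        (conjugate (P i))^-1%R)).

(* With [0^-1 = +oo] and [0 * +oo = 0] in \bar R, a cube of zero [v]-mass
   contributes 0 if its tent is [mu]-null and +oo otherwise. *)
Definition C_infty_constant (mu : set (n.-tuple R * R) -> \bar R)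
    (v : n.-tuple R -> R) : \bar R :=
  ereal_sup (range (fun Q : cube R n =>
    mu (tent Q) * (\int[lebRn]_(x in cube_set Q) (v x)%:E)^-1)).

(* The [L^p(mu)] norm over the upper half-space; p may be smaller than 1. *)
Definition half_space_norm (mu : set (n.-tuple R * R) -> \bar R) (p : R)
    (F : n.-tuple R * R -> \bar R) : \bar R :=
  poweR (\int[mu]_(z in upper_half_space) poweR `|F z| p) p^-1%R.

End maximal_operator.

(* Main.v *)
Require Import Defs.
From mathcomp Require Import all_boot all_order all_algebra.
From mathcomp Require Import all_classical all_reals all_analysis measurable_realfun.
From mathcomp Require Import ring lra zify.
Import Order.TTheory GRing.Theory Num.Theory.
Local Open Scope classical_set_scope.
Local Open Scope ring_scope.

(* Write [sigma_i = w_i ^ (1 - p_i')] and [pb = max p_i'].  For a finite family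
   of dyadic cubes let [M_i] be the maximal function of the [sigma_i]-averages of
   [f_i / sigma_i], and put [h = \prod_i (M_i sigma_i) ^ (p / pb)].  Hoelder's
   inequality on a cube [Q] of the family and the [A_P] condition give the
   pointwise bound
     [\prod_i avg_Q f_i <= A ^ pb * (avg_{v,Q} h) ^ (pb / p)],
   so the [L^p(mu)] norm of the dyadic operator is controlled by the [L^pb(mu)]
   norm of the maximal function over tents of the [v]-averages of [h].  By the
   [C_infty] condition (a Carleson embedding) the latter is at most a multiple of
   the [L^pb(v)] norm of [h], and Hoelder's inequality together with the dyadic
   maximal theorem for each [sigma_i] bounds it by the product of the norms of the
   [f_i].  Both maximal inequalities follow by inserting the cubes one at a time,
   from large to small.

   Every cube is contained in a comparable cube of one of [2 ^ n] dyadic grids of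
   scale at most [2 ^ N] shifted by [2 ^ N / 3] in some directions, and Fatou's
   lemma passes to the limit in [N].  The [A_P] condition forces the weights to be
   positive almost everywhere unless [v = 0], and then [mu] vanishes on the
   half-space. *)

Set Implicit Arguments.
Unset Strict Implicit.
Unset Printing Implicit Defensive.

(** * Inequalities between real powers *)

Section real_inequalities.
Context {R : realType}.

(** The tangent of the exponential at the weighted mean [L] of the logarithms lies below the graph;
    averaging the tangent inequalities with the weights [t i] removes the linear term. *)
Lemma weighted_amgm (I : finType) (t x : I -> R) :
  (forall i, 0 <= t i) -> (forall i, 0 <= x i) -> \sum_i t i = 1 ->
  \prod_i x i `^ t i <= \sum_i t i * x i.
Proof.
move=> t0 x0 t1.
(* A zero factor with nonzero exponent annihilates the product; any other zero factor has exponent 0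
   and may be replaced by 1, so that all logarithms are meaningful. *)
have [/existsP[i /andP[/eqP xi0 ti0]]|/existsPn xt0] :=
    boolP [exists i, (x i == 0) && (t i != 0)].
  rewrite (bigD1 i) //= xi0 powR0// mul0r.
  by apply: sumr_ge0 => j _; rewrite mulr_ge0.
pose y i := if x i == 0 then 1 else x i.
have y0 i : 0 < y i by rewrite /y; case: eqVneq => // xi; rewrite lt_neqAle eq_sym xi x0.
have tx i : x i == 0 -> t i = 0.
  by move=> xi; have := xt0 i; rewrite xi /= negbK => /eqP.
rewrite (_ : \prod_i _ = \prod_i y i `^ t i); last first.
  by apply: eq_bigr => i _; rewrite /y; case: ifPn => // xi; rewrite tx // !powRr0.
rewrite (_ : \sum_i _ = \sum_i t i * y i); last first.
  by apply: eq_bigr => i _; rewrite /y; case: ifPn => // xi; rewrite tx // !mul0r.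
pose L := \sum_i t i * ln (y i).
have -> : \prod_i y i `^ t i = expR L.
  rewrite /L expR_sum; apply: eq_bigr => i _.
  by rewrite /powR gt_eqF.
have {1}-> : expR L = \sum_i t i * (expR L * (1 + (ln (y i) - L))).
  transitivity (expR L * (\sum_i t i * (1 - L) + L)); last first.
    rewrite /L -big_split mulr_sumr /=; apply: eq_bigr => i _; ring.
  by rewrite -mulr_suml t1; ring.
apply: ler_sum => i _; apply: ler_wpM2l => //.
have {2}-> : y i = expR L * expR (ln (y i) - L).
  by rewrite -expRD addrC subrK lnK // posrE.
by apply: ler_wpM2l; [exact: expR_ge0|exact: expR_ge1Dx].
Qed.

Lemma powR_prod (I : Type) (s : seq I) (x : I -> R) (r : R) :
  (forall i, 0 <= x i) -> (\prod_(i <- s) x i) `^ r = \prod_(i <- s) x i `^ r.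
Proof.
move=> x0; elim: s => [|i s ih]; first by rewrite !big_nil powR1.
by rewrite !big_cons powRM ?ih // prodr_ge0.
Qed.

Lemma prodr_powR_exp (I : Type) (s : seq I) (x : R) (r : I -> R) : 0 < x ->
  \prod_(i <- s) x `^ r i = x `^ (\sum_(i <- s) r i).
Proof.
move=> x0; elim: s => [|i s ih]; first by rewrite !big_nil powRr0.
by rewrite !big_cons ih powRD //; apply/implyP => _; rewrite gt_eqF.
Qed.

(* The mean value inequality for [x ^ r], as a weighted AM-GM inequality. *)
Lemma powR_increment_le (r c l : R) : 1 < r -> 0 <= l -> l <= c ->
  c `^ r - l `^ r <= r / (r - 1) * (c * (c `^ (r - 1) - l `^ (r - 1))).
Proof.
move=> r1 l0 lc.
have c0 : 0 <= c by exact: le_trans lc.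
have rr : 0 < r by lra.
have r1' : 0 < r - 1 by lra.
have -> : c * (c `^ (r - 1) - l `^ (r - 1)) = c `^ r - c * l `^ (r - 1).
  by rewrite mulrBr mulr_powRB1.
have := @weighted_amgm bool (fun b => if b then (r - 1) / r else r^-1)
  (fun b => if b then l `^ r else c `^ r).
rewrite !big_bool /= -!powRrM.
have T1 : forall b : bool, 0 <= if b then (r - 1) / r else r^-1.
  by move=> [|]; rewrite ?invr_ge0 ?divr_ge0 // ltW.
have T2 : forall b : bool, 0 <= if b then l `^ r else c `^ r.
  by move=> [|]; rewrite powR_ge0.
have T3 : (r - 1) / r + r^-1 = 1 by field; rewrite gt_eqF.
move=> /(_ T1 T2 T3) {T1 T2 T3}.
rewrite (_ : r * ((r - 1) / r) = r - 1); last by field; rewrite gt_eqF.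
rewrite divff ?gt_eqF // powRr1 // => H.
have {}H : r / (r - 1) * (l `^ (r - 1) * c) <= l `^ r + (r - 1)^-1 * c `^ r.
  have -> : l `^ r + (r - 1)^-1 * c `^ r = 
    r / (r - 1) * ((r - 1) / r * l `^ r + r^-1 * c `^ r).
    by field; rewrite !gt_eqF.
  by apply: ler_wpM2l => //; rewrite divr_ge0 ?ltW.
rewrite mulrBr (mulrC c).
have -> : r / (r - 1) * c `^ r = c `^ r + (r - 1)^-1 * c `^ r.
  by field; rewrite !gt_eqF.
lra.
Qed.

(** Either [x] dominates [2 * a * h] or it is smaller, and in each case one term on the right
    suffices. The factor [2^-1] allows the first term to be absorbed in the maximal theorem. *)
Lemma young_crude (a r h x : R) : 1 < r -> 0 < a -> 0 <= h -> 0 <= x ->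
  a * h * x `^ (r - 1) <= 2^-1 * x `^ r + (2 * a) `^ r * h `^ r.
Proof.
move=> r1 a0 h0 x0.
have xr : x * x `^ (r - 1) = x `^ r.
  by rewrite mulr_powRB1 //; lra.
have [ahx|xah] := leP (2 * a * h) x.
  apply: ler_wpDr; first by rewrite mulr_ge0 ?powR_ge0.
  rewrite -xr mulrA; apply: ler_wpM2r; first exact: powR_ge0.
  lra.
apply: ler_wpDl; first by rewrite mulr_ge0 ?powR_ge0 // invr_ge0.
have ah0 : 0 <= 2 * a * h by rewrite !mulr_ge0 // ltW.
rewrite -powRM ?mulr_ge0 ?(ltW a0) //.
have -> : (2 * a * h) `^ r = 2 * a * h * (2 * a * h) `^ (r - 1).
  by rewrite mulr_powRB1 //; lra.
apply: ler_pM; rewrite ?mulr_ge0 ?powR_ge0 ?(ltW a0) //.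
  by have := mulr_ge0 (ltW a0) h0; lra.
by apply: ge0_ler_powR; rewrite ?nnegrE ?(ltW xah) //; lra.
Qed.

End real_inequalities.

(** * Exponents relating the weights to their dual weights *)

Section exponent_identities.
Context {R : realType}.
Implicit Types x y w M : R.

Lemma powRD_gt0 x (r s : R) : 0 < x -> x `^ (r + s) = x `^ r * x `^ s.
Proof. by move=> x0; rewrite powRD //; apply/implyP => _; rewrite gt_eqF. Qed.

Context (P : R).
Local Notation q := (conjugate P).

Lemma conjugate_gt1 : 1 < P -> 1 < q.
Proof. by move=> P1; rewrite /conjugate ltr_pdivlMr; lra. Qed.

Lemma conjugate_inv : 1 < P -> q^-1 = 1 - P^-1.
Proof.
move=> P1; have P0 : P != 0 by rewrite gt_eqF //; lra.
have Pm1 : P - 1 != 0 by rewrite gt_eqF //; lra.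
by rewrite /conjugate; field; rewrite ?P0 ?Pm1.
Qed.

Lemma dual_weight_cancel F w : 0 < w -> F * w `^ (q - 1) * w `^ (1 - q) = F.
Proof. by move=> w0; rewrite -mulrA -powRD_gt0 // addrA subrK subrr powRr0 mulr1. Qed.

(** Passing from [f] in [L^P(w)] to [f / sigma] in [L^P(sigma)], where [sigma = w ^ (1 - q)], keeps
    the norm because [(q - 1) * (P - 1) = 1]. *)
Lemma dual_weight_norm F w : 1 < P -> 0 <= F -> 0 < w ->
  (F * w `^ (q - 1)) `^ P * w `^ (1 - q) = F `^ P * w.
Proof.
move=> P1 F0 w0; rewrite powRM ?powR_ge0 // -mulrA -powRrM -powRD_gt0 //.
rewrite (_ : (q - 1) * P + (1 - q) = 1) ?powRr1 //; first exact: ltW.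
have Pm1 : P - 1 != 0 by rewrite gt_eqF //; lra.
by rewrite /conjugate; field; rewrite ?Pm1.
Qed.

(** One factor of [h ^ pb * v], put into the form to which Hoelder's inequality with the exponents
    [p / P i], of sum 1, applies. *)
Lemma dual_weight_split (p pb : R) M w : 1 < P -> 0 <= M -> 0 < w -> pb != 0 ->
  ((M * w `^ (1 - q)) `^ (p / pb)) `^ pb * w `^ (p / P) =
  (M `^ P * w `^ (1 - q)) `^ (p / P).
Proof.
move=> P1 M0 w0 pb0; rewrite !powRM ?powR_ge0 // -!powRrM -mulrA -powRD_gt0 //.
have P0 : P != 0 by rewrite gt_eqF //; lra.
have Pm1 : P - 1 != 0 by rewrite gt_eqF //; lra.
by congr (_ `^ _ * _ `^ _); rewrite /conjugate; field; rewrite ?P0 ?Pm1 ?pb0.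
Qed.

(** One factor of the integrand in Hoelder's inequality on a cube: the exponents are such that all
    powers of [w] cancel. *)
Lemma dual_weight_interpolate (p pb k : R) M w : 1 < P -> 0 <= M -> 0 < w ->
  pb != 0 -> p != 0 -> k != 0 ->
  ((M * w `^ (1 - q)) `^ (p / pb) * w `^ (p / P)) `^ (pb / p / k) *
    (w `^ (1 - q)) `^ ((pb / q - 1) / k) = M `^ k^-1.
Proof.
move=> P1 M0 w0 pb0 p0 k0; rewrite !powRM ?mulr_ge0 ?powR_ge0 // -!powRrM.
rewrite -!mulrA -!powRD_gt0 // [X in _ * _ `^ X](_ : _ = 0).
  by rewrite powRr0 mulr1; congr (_ `^ _); field; rewrite k0 pb0 p0.
have P0 : P != 0 by rewrite gt_eqF //; lra.
have Pm1 : P - 1 != 0 by rewrite gt_eqF //; lra.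
by rewrite /conjugate; field; rewrite ?P0 ?Pm1 ?pb0 ?p0 ?k0.
Qed.

End exponent_identities.

(** * Exponent bookkeeping for the product of averages *)

Section multilinear_average.
Context {R : realType} (m : nat).

(* The A_P constant of a cube enters with the power [pb] because
   [m * pb = k + m] where [k = m * (pb - 1)]. *)
Lemma product_average_le (p pb : R) (P Sg s : 'I_m -> R) (Vol V c : R) :
  0 < p -> (forall i, 1 < P i) -> p^-1 = \sum_(i < m) (P i)^-1 -> 1 < pb -> (0 < m)%N ->
  0 < Vol -> 0 < V -> 0 <= c -> (forall i, 0 < Sg i) -> (forall i, 0 <= s i) ->
  let k := m%:R * (pb - 1) in
  Vol * \prod_i s i `^ k^-1 <=
    (c * V) `^ (pb / p / k) * \prod_i Sg i `^ ((pb / conjugate (P i) - 1) / k) ->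
  \prod_i (s i * Sg i / Vol) <=
    ((V / Vol) `^ p^-1 * \prod_i (Sg i / Vol) `^ (conjugate (P i))^-1) `^ pb * c `^ (pb / p).
Proof.
move=> p0 P1 pE pb1 m0 Vol0 V0 c0 Sg0 s0 k hyp.
have k0 : 0 < k by rewrite mulr_gt0 ?ltr0n // subr_gt0.
(* Raising to the power [k] clears the roots of the [s i]. *)
have {}hyp : Vol `^ k * \prod_i s i <=
    (c * V) `^ (pb / p) * \prod_i Sg i `^ (pb / conjugate (P i) - 1).
  have p1 : 0 <= \prod_i s i `^ k^-1 by apply: prodr_ge0 => i _; exact: powR_ge0.
  have p2 : 0 <= \prod_i Sg i `^ ((pb / conjugate (P i) - 1) / k).
    by apply: prodr_ge0 => i _; exact: powR_ge0.
  have := ge0_ler_powR (ltW k0) _ _ hyp.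
  rewrite !nnegrE !mulr_ge0 ?powR_ge0 ?(ltW Vol0) // => /(_ isT isT).
  rewrite (powRM _ (ltW Vol0)) // (powRM _ (powR_ge0 _ _)) //.
  rewrite !powR_prod; try by move=> i; exact: powR_ge0.
  rewrite -!powRrM !mulfVK ?gt_eqF // => H.
  rewrite (eq_bigr s) in H; last first.
    by move=> i _; rewrite -powRrM mulVf ?gt_eqF // powRr1.
  rewrite [X in _ <= _ * X](eq_bigr (fun i => Sg i `^ (pb / conjugate (P i) - 1))) in H => //.
  by move=> i _; rewrite -powRrM mulfVK // gt_eqF.
have iVol : 0 <= Vol^-1 by rewrite invr_ge0 ltW.
have iV r : Vol^-1 `^ r = Vol `^ (- r) by rewrite -powR_inv1 ?ltW // -powRrM mulN1r.
have -> : \prod_i (s i * Sg i / Vol) =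
    (Vol `^ k * \prod_i s i) * (\prod_i Sg i * Vol `^ (- (m%:R * pb))).
  have -> : - (m%:R * pb) = - k - m%:R by rewrite /k; ring.
  rewrite powRD_gt0 // powRN (powRN _ m%:R) powR_mulrn ?ltW // !big_split /=.
  rewrite prodr_const card_ord exprVn.
  by field; rewrite expf_neq0 ?gt_eqF // powR_gt0.
apply: (@le_trans _ _ ((c * V) `^ (pb / p) * \prod_i Sg i `^ (pb / conjugate (P i) - 1) *
    (\prod_i Sg i * Vol `^ (- (m%:R * pb))))).
  apply: ler_wpM2r => //; apply: mulr_ge0; last exact: powR_ge0.
  by apply: prodr_ge0 => i _; exact: ltW.
(* This makes the powers of [Vol] on the two sides agree. *)
have pq : p^-1 + \sum_(i < m) (conjugate (P i))^-1 = m%:R.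
  rewrite pE -big_split /= (eq_bigr (fun=> 1)) ?sumr_const ?card_ord // => i _.
  by rewrite conjugate_inv // addrCA subrr addr0.
rewrite [X in _ <= X * _]powRM; [|exact: powR_ge0|by apply: prodr_ge0 => i _; exact: powR_ge0].
rewrite powR_prod; last by move=> i; exact: powR_ge0.
under [X in _ <= _ * X * _]eq_bigr => i _.
  rewrite -powRrM powRM ?iV ?(ltW (Sg0 i)) //.
  over.
rewrite big_split /= prodr_powR_exp // -powRrM !powRM ?(ltW V0) // iV sumrN -mulr_suml.
have -> : \prod_i Sg i `^ ((conjugate (P i))^-1 * pb) =
    \prod_i Sg i `^ (pb / conjugate (P i) - 1) * \prod_i Sg i.
  rewrite -big_split; apply: eq_bigr => i _ /=.
  by rewrite -{3}(powRr1 (ltW (Sg0 i))) -powRD_gt0 // subrK mulrC.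
rewrite (mulrC _^-1 pb).
have -> : - (m%:R * pb) = - (pb / p) - (\sum_(i < m) (conjugate (P i))^-1) * pb.
  by rewrite -pq; ring.
rewrite powRD_gt0 // le_eqVlt; apply/orP; left; apply/eqP; ring.
Qed.

End multilinear_average.

(** * Integrals *)

Section integral_inequalities.
Local Open Scope ereal_scope.
Context d (T : measurableType d) (R : realType).
Variable mu : {measure set T -> \bar R}.

Import HBNNSimple.

(** The integral of a nonnegative function is a supremum over simple functions below it. Setting
    such a simple function to 0 on the exceptional null set keeps its integral and puts it below
    [g], so [f] and [g] may be arbitrary nonnegative functions. *)
Lemma ae_ge0_le_integral (D : set T) (f g : T -> \bar R) :
  (forall x, 0 <= f x) -> (forall x, 0 <= g x) ->
  {ae mu, forall x, D x -> f x <= g x} ->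
  \int[mu]_(x in D) f x <= \int[mu]_(x in D) g x.
Proof.
move=> f0 g0 [N [mN N0 fgN]].
rewrite !ge0_integralE //; apply: ge_ereal_sup => _ [h /= hf <-].
pose h' := proj_nnsfun h (measurableC mN).
have -> : sintegral mu h = sintegral mu h'.
  rewrite -!integralT_nnsfun; apply: ge0_ae_eq_integral => //.
  - exact/measurable_EFinP.
  - exact/measurable_EFinP.
  - by move=> x _; rewrite lee_fin.
  - by move=> x _; rewrite lee_fin.
  - exists N; split => // x /= /not_implyP[_]; apply: contra_notP => Nx.
    by rewrite /= mindicE mem_set // mulr1.
apply: ereal_sup_ubound; exists h' => //= x.
have [Nx|Nx] := pselect (N x).
  rewrite mindicE memNset; last by move=> /(_ Nx).
  by rewrite mulr0 /patch; case: ifP.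
rewrite mindicE mem_set // mulr1 (le_trans (hf x)) // /patch.
case: ifPn => //; rewrite inE => Dx; apply: contrapT => fg.
by apply: Nx; apply: fgN => /(_ Dx).
Qed.

Lemma ge0_le_integral_nonmeasurable (D : set T) (f g : T -> \bar R) :
  (forall x, 0 <= f x) -> (forall x, 0 <= g x) -> (forall x, D x -> f x <= g x) ->
  \int[mu]_(x in D) f x <= \int[mu]_(x in D) g x.
Proof. by move=> f0 g0 fg; apply: ae_ge0_le_integral => //; apply: aeW. Qed.

Lemma ae_ge0_eq_integral (D : set T) (f g : T -> \bar R) :
  (forall x, 0 <= f x) -> (forall x, 0 <= g x) ->
  {ae mu, forall x, f x = g x} ->
  \int[mu]_(x in D) f x = \int[mu]_(x in D) g x.
Proof.
move=> f0 g0 fg; apply/eqP; rewrite eq_le; apply/andP; split;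
  apply: ae_ge0_le_integral => //; apply: filterS fg => x -> //.
Qed.

Lemma integral_gt0 (D : set T) (f : T -> R) : measurable D -> 0 < mu D ->
  measurable_fun D f -> (forall x, (0 < f x)%R) -> 0 < \int[mu]_(x in D) (f x)%:E.
Proof.
move=> mD D0 mf f0; rewrite lt0e integral_ge0 ?andbT; last first.
  by move=> x _; rewrite lee_fin ltW.
apply/eqP => If0; move: D0; apply/negP; rewrite -leNgt.
have mEf : measurable_fun D (EFin \o f) by exact/measurable_EFinP.
have : \int[mu]_(x in D) `|(EFin \o f) x| = 0.
  by rewrite -[RHS]If0; apply: eq_integral => x _; rewrite gee0_abs // lee_fin ltW.
move=> /(ae_eq_integral_abs mu mD mEf) [N [mN N0 DN]].
rewrite -N0; apply: le_measure; rewrite ?inE // => x Dx; apply: DN => /(_ Dx).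
by move=> -[fx]; have := f0 x; rewrite fx ltxx.
Qed.

Lemma integral_scale_indic (A : set T) (f : T -> R) (q : R) :
  measurable A -> measurable_fun [set: T] f -> (forall x, 0 <= f x)%R ->
  (0 <= q)%R ->
  \int[mu]_x (q * \1_A x * f x)%:E = q%:E * \int[mu]_(x in A) (f x)%:E.
Proof.
move=> mA mf f0 q0.
rewrite (integral_mkcond A) -ge0_integralZl_EFin //.
- apply: eq_integral => x _; rewrite /patch indicE.
  by case: ifPn => _; rewrite ?mulr1 ?mulr0 ?mul0r ?mule0 // EFinM.
- by move=> x _; rewrite /patch; case: ifP; rewrite ?lee_fin.
- by apply/(measurable_restrictT _ mA)/measurable_EFinP; exact: measurable_funTS.
Qed.

(** Hoelder's inequality for finitely many functions, with exponents [1 / t i]: after normalising by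
    the bounds [b i], the pointwise weighted AM-GM inequality is integrated. *)
Lemma integral_prod_powR_le (I : finType) (D : set T) (t : I -> R)
    (f : I -> T -> R) (b : I -> R) : measurable D ->
  (forall i, 0 <= t i)%R -> (\sum_i t i = 1)%R ->
  (forall i x, 0 <= f i x)%R -> (forall i, measurable_fun D (f i)) ->
  (forall i, \int[mu]_(x in D) (f i x)%:E <= (b i)%:E) ->
  \int[mu]_(x in D) (\prod_i f i x `^ t i)%:E <= (\prod_i b i `^ t i)%:E.
Proof.
move=> mD t0 t1 f0 mf fb.
have b0 i : (0 <= b i)%R.
  by rewrite -lee_fin (le_trans _ (fb i)) // integral_ge0 // => x _; rewrite lee_fin.
have mp : measurable_fun D (fun x => \prod_i f i x `^ t i)%R.
  apply: measurable_prod => i _; exact: measurableT_comp (measurable_powR _) (mf i).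
have p0 x : (0 <= \prod_i f i x `^ t i)%R by apply: prodr_ge0 => i _; exact: powR_ge0.
(* If [b i = 0] with a nonzero exponent, then [f i], and with it the product, vanishes almost
   everywhere. *)
have [/existsP[i /andP[/eqP bi0 ti0]]|/existsPn bt0] :=
    boolP [exists i, (b i == 0%R) && (t i != 0%R)].
  rewrite [leLHS](_ : _ = 0); first by rewrite lee_fin prodr_ge0 // => j _; exact: powR_ge0.
  have mEf : measurable_fun D (EFin \o f i) by exact/measurable_EFinP.
  have fi0 : \int[mu]_(x in D) `|(EFin \o f i) x| = 0.
    apply/eqP; rewrite eq_le integral_ge0 // andbT.
    have := fb i; rewrite bi0; apply: le_trans.
    by rewrite (eq_integral (EFin \o f i)) // => x _; rewrite gee0_abs // lee_fin.
  rewrite -[RHS](integral0 mu D); apply: ge0_ae_eq_integral => //.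
  - exact/measurable_EFinP.
  - by move=> x _; rewrite lee_fin.
  - move/(ae_eq_integral_abs mu mD mEf) : fi0.
    apply: filterS => x /[apply] -[fx].
    by rewrite /cst (bigD1 i) //= fx powR0 // mul0r.
(* The remaining zero bounds carry exponent 0; replacing them by 1 permits division. *)
pose y i := (if b i == 0 then 1 else b i)%R.
have y0 i : (0 < y i)%R.
  by rewrite /y; case: eqVneq => // bi; rewrite lt_neqAle eq_sym bi b0.
have -> : (\prod_i b i `^ t i = \prod_i y i `^ t i)%R.
  apply: eq_bigr => i _; rewrite /y; case: ifPn => // bi.
  by have := bt0 i; rewrite bi /= negbK => /eqP ->; rewrite !powRr0.
have fy i : \int[mu]_(x in D) (f i x)%:E <= (y i)%:E.
  by rewrite (le_trans (fb i)) // lee_fin /y; case: eqVneq => // ->.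
pose g x := (\sum_i t i * (y i)^-1 * f i x)%R.
have fg x : (\prod_i f i x `^ t i <= \prod_i y i `^ t i * g x)%R.
  have -> : (\prod_i f i x `^ t i = \prod_i y i `^ t i * \prod_i ((y i)^-1 * f i x) `^ t i)%R.
    rewrite -big_split; apply: eq_bigr => i _ /=; rewrite -powRM.
    - by rewrite mulrA divff ?mul1r // gt_eqF.
    - exact: ltW.
    - by rewrite mulr_ge0 // invr_ge0 ltW.
  apply: ler_wpM2l; first by apply: prodr_ge0 => i _; exact: powR_ge0.
  rewrite /g; under [X in (_ <= X)%R]eq_bigr do rewrite -mulrA.
  by apply: weighted_amgm => // i; rewrite mulr_ge0 // invr_ge0 ltW.
have g0 x : (0 <= g x)%R.
  by apply: sumr_ge0 => i _; rewrite !mulr_ge0 // invr_ge0 ltW.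
have mg : measurable_fun D g.
  by apply: measurable_sum => i; apply: measurable_funM => //.
have y_ge0 : (0 <= \prod_i y i `^ t i)%R.
  by apply: prodr_ge0 => i _; exact: powR_ge0.
apply: (@le_trans _ _ (\int[mu]_(x in D) ((\prod_i y i `^ t i)%:E * (g x)%:E))).
  by apply: ge0_le_integral_nonmeasurable => x *; rewrite -?EFinM lee_fin // mulr_ge0.
rewrite ge0_integralZl //; first last.
- by move=> x _; rewrite lee_fin.
- exact/measurable_EFinP.
rewrite -[leRHS]mule1; apply: lee_wpmul2l; first by rewrite lee_fin.
have yg : \int[mu]_(x in D) (g x)%:E = \sum_i \int[mu]_(x in D) ((t i * (y i)^-1 * f i x)%:E).
  under eq_integral do rewrite /g -sumEFin.
  apply: ge0_integral_sum => // [i|i x _].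
    by apply/measurable_EFinP/measurable_funM.
  by rewrite lee_fin !mulr_ge0 // invr_ge0 ltW.
rewrite yg -[leRHS]/(1%R%:E) -t1 -sumEFin; apply: lee_sum => i _.
under eq_integral do rewrite EFinM.
rewrite ge0_integralZl //; first last.
- by rewrite lee_fin mulr_ge0 // invr_ge0 ltW.
- by move=> x _; rewrite lee_fin.
- exact/measurable_EFinP.
have ty : (0 <= t i / y i)%R by rewrite divr_ge0 // ltW.
apply: (@le_trans _ _ ((t i / y i)%:E * (y i)%:E)).
  by apply: lee_wpmul2l; rewrite ?lee_fin // fy.
by rewrite -EFinM lee_fin mulfVK // gt_eqF.
Qed.

End integral_inequalities.

(** * Maximal functions over finite laminar families *)

Section finite_maximal_function.
Context {R : realType} {K : eqType}.

(** With [Q] a family of cubes this is a maximal function on the base space; with their tents and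
    the same coefficients [c] it is one on the half-space. The value is 0 off the whole family. *)
Definition finite_max {T : Type} (s : seq K) (c : K -> R) (Q : K -> set T) (x : T) : R :=
  \big[Num.max/0]_(k <- s) (c k * \1_(Q k) x).

Section pointwise.
Context {T : Type}.
Implicit Types (s : seq K) (c : K -> R) (Q : K -> set T).

Lemma finite_max_ge0 s c Q x : 0 <= finite_max s c Q x.
Proof. by rewrite /finite_max; elim/big_rec: _ => // i y _ y0; rewrite le_max y0 orbT. Qed.

Lemma le_finite_max s c Q x k : k \in s -> Q k x -> c k <= finite_max s c Q x.
Proof.
move=> ks Qx; rewrite /finite_max.
have -> : c k = c k * \1_(Q k) x by rewrite indicE mem_set // mulr1.
elim: s ks => // l s ih; rewrite inE big_cons le_max => /predU1P[->|/ih ->].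
  by rewrite lexx.
by rewrite orbT.
Qed.

Lemma finite_max_le s c Q x b : 0 <= b ->
  (forall k, k \in s -> Q k x -> c k <= b) -> finite_max s c Q x <= b.
Proof.
move=> b0 cb; rewrite /finite_max big_seq; elim/big_rec: _ => // k y ks yb.
rewrite ge_max yb andbT indicE; have [/set_mem Qx|_] := boolP (x \in Q k).
  by rewrite mulr1 cb.
by rewrite mulr0.
Qed.

Lemma finite_max_cons k s c Q x :
  finite_max (k :: s) c Q x = Num.max (c k * \1_(Q k) x) (finite_max s c Q x).
Proof. by rewrite /finite_max big_cons. Qed.

End pointwise.

(* The list is ordered upwards: a cube is inserted after all the cubes that
   contain it have been. *)
Fixpoint laminar {T Z : Type} (Q : K -> set T) (U : K -> set Z) (s : seq K) : Prop :=
  if s is k :: s' then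
    (forall l, l \in s' ->
       (Q k `<=` Q l /\ U k `<=` U l) \/ Q k `&` Q l = set0) /\
    laminar Q U s'
  else True.

(** Taking the cubes themselves as tents turns an estimate over tents into the ordinary maximal
    inequality. *)
Lemma laminar_diag {T Z : Type} (Q : K -> set T) (U : K -> set Z) s :
  laminar Q U s -> laminar Q Q s.
Proof.
elim: s => // k s ih [kl /ih ?]; split => // l /kl[[? _]|?]; by [left|right].
Qed.

Lemma measurable_finite_max d (T : measurableType d) s c (Q : K -> set T) :
  (forall k, measurable (Q k)) ->
  measurable_fun [set: T] (finite_max s c Q).
Proof.
move=> mQ; elim: s => [|k s ih].
  rewrite (_ : finite_max _ _ _ = cst 0) //.
  by apply/funext => x; rewrite /finite_max big_nil.
rewrite (_ : finite_max _ _ _ = (fun x => c k * \1_(Q k) x) \max finite_max s c Q); last first.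
  by apply/funext => x; rewrite finite_max_cons.
by apply: measurable_maxr => //; apply: measurable_funM => //; exact: measurable_indic.
Qed.

(** Every cube of [s] contains [Q k] or misses it, so each indicator is constant on [Q k]. *)
Lemma finite_max_cst {T Z : Type} (Q : K -> set T) (U : K -> set Z) k s c x y :
  laminar Q U (k :: s) -> Q k x -> Q k y ->
  finite_max s c Q x = finite_max s c Q y.
Proof.
move=> [kl _] Qx Qy; rewrite /finite_max; apply: eq_big_seq => l /kl[[QQ _]|QQ].
  by rewrite !indicE !mem_set //; exact: QQ.
have notin z : Q k z -> (z \in Q l) = false.
  move=> Qz; apply: memNset => Qlz; suff : set0 z by [].
  by rewrite -QQ.
by rewrite !indicE !notin.
Qed.

Local Open Scope ereal_scope.

(** * Inserting cubes one at a time *)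

Section domination.
Context d (T : measurableType d) d' (Z : measurableType d').
Variables (lam : {measure set T -> \bar R}) (mu : {measure set Z -> \bar R}).
Variables (Q : K -> set T) (U : K -> set Z) (c V : K -> R) (u : T -> R) (om : Z -> R).
Variables (B r : R).
Hypotheses (mQ : forall k, measurable (Q k)) (mU : forall k, measurable (U k)).
Hypotheses (Q0 : forall k, Q k !=set0).
Hypotheses (mu_ : measurable_fun [set: T] u) (mom : measurable_fun [set: Z] om).
Hypotheses (u0 : forall x, (0 <= u x)%R) (om0 : forall z, (0 <= om z)%R).
Hypotheses (c0 : forall k, (0 <= c k)%R) (B0 : (0 <= B)%R) (r1 : (1 < r)%R).
Hypothesis cV : forall k, \int[lam]_(x in Q k) (u x)%:E = (c k * V k)%:E.
Hypothesis UV : forall k, \int[mu]_(z in U k) (om z)%:E <= (B * V k)%:E.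

(* On a newly inserted cube the old maximum is a constant [L], so the left-hand
   side grows by at most [B * (c ^ r - L ^ r) * V] and the integral on the right by
   exactly [(c ^ (r - 1) - L ^ (r - 1)) * c * V]. *)
Lemma finite_max_integral_le s : laminar Q U s ->
  \int[mu]_z (finite_max s c U z `^ r * om z)%:E <=
  (B * (r / (r - 1)))%:E * \int[lam]_x (finite_max s c Q x `^ (r - 1) * u x)%:E.
Proof.
have V0 k : (0 <= B * V k)%R.
  by rewrite -lee_fin (le_trans _ (UV k)) // integral_ge0 // => z _; rewrite lee_fin.
have r1' := r1.
have rr : (0 <= r / (r - 1))%R.
  by apply: divr_ge0; lra.
elim: s => [_|k s ih lks].
  rewrite integral0_eq; last first.
    by move=> z _; rewrite /finite_max big_nil powR0 ?mul0r //; rewrite gt_eqF //; lra.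
  apply: mule_ge0; first by rewrite lee_fin mulr_ge0.
  by apply: integral_ge0 => x _; rewrite lee_fin mulr_ge0 // powR_ge0.
have [kl ls] := lks.
have [x0 Qx0] := Q0 k.
pose L := finite_max s c Q x0.
have L0 : (0 <= L)%R by exact: finite_max_ge0.
pose e := Num.max (c k) L.
have Le : (L <= e)%R by rewrite le_max lexx orbT.
pose a := (e `^ r - L `^ r)%R.
pose b := (e `^ (r - 1) - L `^ (r - 1))%R.
have a0 : (0 <= a)%R by rewrite subr_ge0 ge0_ler_powR ?nnegrE //; [lra|exact: le_trans Le].
have b0 : (0 <= b)%R by rewrite subr_ge0 ge0_ler_powR ?nnegrE //; [lra|exact: le_trans Le].
(* On [U k] only an inequality holds, since [U l] may meet [U k] even when the cubes are disjoint;
   but a larger old maximum only lowers the increment. *)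
have Uk z : U k z -> (L <= finite_max s c U z)%R.
  move=> Uz; apply: finite_max_le => [|l ls' Qlx0]; first exact: finite_max_ge0.
  apply: le_finite_max => //.
  case: (kl l ls') => [[_ UU]|QQ]; first exact: UU.
  by suff : set0 x0 by []; rewrite -QQ.
have incU z : (finite_max (k :: s) c U z `^ r <=
    finite_max s c U z `^ r + a * \1_(U k) z)%R.
  have N0 := finite_max_ge0 s c U z.
  rewrite finite_max_cons indicE; have [/set_mem Uz|_] := boolP (z \in U k); last first.
    by rewrite !mulr0 addr0 max_r.
  rewrite !mulr1; have LN := Uk _ Uz.
  have [cN|Nc] := leP (c k) (finite_max s c U z).
    by rewrite ler_wpDr.
  have -> : a = (c k `^ r - L `^ r)%R by rewrite /a /e max_l // ltW // (le_lt_trans LN).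
  rewrite addrC -addrA addrC -{1}(add0r (c k `^ r)%R) lerD2r addrC subr_ge0.
  by apply: ge0_ler_powR; rewrite ?nnegrE //; lra.
have incQ x : (finite_max (k :: s) c Q x `^ (r - 1) =
    finite_max s c Q x `^ (r - 1) + b * \1_(Q k) x)%R.
  rewrite finite_max_cons indicE; have [/set_mem Qx|_] := boolP (x \in Q k); last first.
    by rewrite !mulr0 addr0 max_r // finite_max_ge0.
  by rewrite !mulr1 (finite_max_cst c lks Qx Qx0) -/L -/e /b addrCA subrr addr0.
have mM s' : measurable_fun [set: T] (fun x => finite_max s' c Q x `^ (r - 1) * u x)%R.
  apply: measurable_funM => //.
  exact: measurableT_comp (measurable_powR _) (measurable_finite_max _ _ mQ).
have mN s' : measurable_fun [set: Z] (fun x => finite_max s' c U x `^ r * om x)%R.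
  apply: measurable_funM => //.
  exact: measurableT_comp (measurable_powR _) (measurable_finite_max _ _ mU).
rewrite [X in _ <= _ * X](_ : _ = \int[lam]_x (finite_max s c Q x `^ (r - 1) * u x)%:E +
    (b * (c k * V k))%:E); last first.
  rewrite (EFinM b) -cV -integral_scale_indic // -ge0_integralD //.
  - by apply: eq_integral => x _; rewrite -EFinD incQ mulrDl.
  - by move=> x _; rewrite lee_fin mulr_ge0 // powR_ge0.
  - exact/measurable_EFinP.
  - by move=> x _; rewrite lee_fin !mulr_ge0.
  - apply/measurable_EFinP; apply: measurable_funM => //.
    by apply: measurable_funM => //; exact: measurable_indic.
rewrite ge0_muleDr; last 2 first.
- by apply: integral_ge0 => x _; rewrite lee_fin mulr_ge0 // powR_ge0.
- have [] := leP 0%R (c k * V k)%R => cVk; first by rewrite lee_fin mulr_ge0.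
  by move: cVk; rewrite -lte_fin -cV ltNge integral_ge0 // => x _; rewrite lee_fin.
apply: (@le_trans _ _ (\int[mu]_z (finite_max s c U z `^ r * om z)%:E +
    a%:E * \int[mu]_(z in U k) (om z)%:E)).
  rewrite -integral_scale_indic // -ge0_integralD //.
  - apply: ge0_le_integral_nonmeasurable => z *.
    + by rewrite lee_fin mulr_ge0 // powR_ge0.
    + by rewrite lee_fin addr_ge0 ?mulr_ge0 // powR_ge0.
    + by rewrite -EFinD lee_fin -mulrDl ler_wpM2r.
  - by move=> x _; rewrite lee_fin mulr_ge0 // powR_ge0.
  - exact/measurable_EFinP.
  - by move=> x _; rewrite lee_fin !mulr_ge0.
  - apply/measurable_EFinP; apply: measurable_funM => //.
    by apply: measurable_funM => //; exact: measurable_indic.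
apply: leeD; first exact: ih.
apply: (@le_trans _ _ (a%:E * (B * V k)%:E)); first by rewrite lee_wpmul2l // lee_fin.
rewrite -!EFinM lee_fin.
rewrite (_ : B * (r / (r - 1)) * (b * (c k * V k)) =
  r / (r - 1) * (c k * b) * (B * V k))%R; last by ring.
apply: ler_wpM2r => //; rewrite /a /b /e.
have [cL|Lc] := leP (c k) L; first by rewrite !subrr !mulr0.
by apply: powR_increment_le => //; exact: ltW.
Qed.

End domination.

(** * The maximal theorem for weighted averages *)

Section strong_type.
Context d (T : measurableType d) d' (Z : measurableType d').
Variables (lam : {measure set T -> \bar R}) (mu : {measure set Z -> \bar R}).
Variables (Q : K -> set T) (U : K -> set Z) (V : K -> R) (v h : T -> R) (om : Z -> R).
Variables (B r H : R).
Hypotheses (mQ : forall k, measurable (Q k)) (mU : forall k, measurable (U k)).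
Hypotheses (Q0 : forall k, Q k !=set0).
Hypotheses (mv : measurable_fun [set: T] v) (mh : measurable_fun [set: T] h).
Hypothesis (mom : measurable_fun [set: Z] om).
Hypotheses (v0 : forall x, (0 <= v x)%R) (h0 : forall x, (0 <= h x)%R).
Hypotheses (om0 : forall z, (0 <= om z)%R) (B0 : (0 <= B)%R) (r1 : (1 < r)%R).
Hypotheses (V0 : forall k, (0 < V k)%R).
Hypothesis vV : forall k, \int[lam]_(x in Q k) (v x)%:E = (V k)%:E.
Hypothesis UV : forall k, \int[mu]_(z in U k) (om z)%:E <= (B * V k)%:E.
Hypothesis hH : \int[lam]_x (h x `^ r * v x)%:E <= H%:E.

Let mhr : measurable_fun [set: T] (fun x => h x `^ r * v x)%R.
Proof. by apply: measurable_funM => //; exact: measurableT_comp (measurable_powR _) mh. Qed.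

Let mhv : measurable_fun [set: T] (fun x => h x * v x)%R.
Proof. exact: measurable_funM. Qed.

Definition weighted_average k : R := (fine (\int[lam]_(x in Q k) (h x * v x)%:E) / V k)%R.

Lemma weighted_average_ge0 k : (0 <= weighted_average k)%R.
Proof.
apply: divr_ge0; last exact: ltW.
by apply/fine_ge0/integral_ge0 => x _; rewrite lee_fin mulr_ge0.
Qed.

(** The point is that the integral is finite, which follows from [h <= 1 + h ^ r]. *)
Lemma weighted_averageE k :
  \int[lam]_(x in Q k) (h x * v x)%:E = (weighted_average k * V k)%:E.
Proof.
rewrite /weighted_average mulfVK ?gt_eqF // fineK // ge0_fin_numE; last first.
  by apply: integral_ge0 => x _; rewrite lee_fin mulr_ge0.
apply: (@le_lt_trans _ _ (\int[lam]_(x in Q k) ((v x)%:E + (h x `^ r * v x)%:E))).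
  apply: ge0_le_integral_nonmeasurable => x *.
  - by rewrite lee_fin mulr_ge0.
  - by rewrite lee_fin addr_ge0 // mulr_ge0 // powR_ge0.
  - rewrite -EFinD lee_fin -{2}(mul1r (v x)) -mulrDl ler_wpM2r //.
    have [hx|/ltW hx] := leP (h x) 1%R; first by rewrite ler_wpDr // powR_ge0.
    by rewrite ler_wpDl // -{1}(powRr1 (h0 x)) ler_powR // ltW.
rewrite ge0_integralD //.
- rewrite vV lte_add_pinfty ?ltry //; apply: le_lt_trans (ltry H); apply: le_trans hH.
  apply: ge0_subset_integral => //; first exact/measurable_EFinP.
  by move=> x _; rewrite lee_fin mulr_ge0 // powR_ge0.
- by move=> x _; rewrite lee_fin.
- by apply/measurable_EFinP; exact: measurable_funTS.
- by move=> x _; rewrite lee_fin mulr_ge0 // powR_ge0.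
- by apply/measurable_EFinP; exact: measurable_funTS.
Qed.

(** A priori finiteness, so that half of this integral can be subtracted later. The power of a
    maximum of two terms is at most the sum of their powers. *)
Lemma finite_max_integral_lty s c : (forall k, 0 <= c k)%R ->
  \int[lam]_x (finite_max s c Q x `^ r * v x)%:E < +oo.
Proof.
move=> c0; have r_neq0 : r != 0%R by rewrite gt_eqF // (lt_trans ltr01).
have mM s' : measurable_fun [set: T] (fun x => finite_max s' c Q x `^ r * v x)%R.
  apply: measurable_funM => //.
  exact: measurableT_comp (measurable_powR _) (measurable_finite_max _ _ mQ).
elim: s => [|k s ih].
  rewrite integral0_eq ?ltry // => x _.
  by rewrite /finite_max big_nil powR0 // mul0r.
apply: (@le_lt_trans _ _ (\int[lam]_x
    ((c k `^ r * \1_(Q k) x * v x)%:E + (finite_max s c Q x `^ r * v x)%:E))).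
  apply: ge0_le_integral_nonmeasurable => x *.
  - by rewrite lee_fin mulr_ge0 // powR_ge0.
  - by rewrite lee_fin addr_ge0 // !mulr_ge0 // powR_ge0.
  - rewrite -EFinD lee_fin -mulrDl ler_wpM2r // finite_max_cons.
    have -> : (c k `^ r * \1_(Q k) x = (c k * \1_(Q k) x) `^ r)%R.
      rewrite indicE; case: (x \in Q k); first by rewrite !mulr1.
      by rewrite !mulr0 powR0.
    by rewrite maxEle; case: ifP => _; rewrite ?lerDl ?lerDr powR_ge0.
rewrite ge0_integralD //.
- rewrite lte_add_pinfty // integral_scale_indic ?powR_ge0 //.
  by rewrite vV -EFinM ltry.
- by move=> x _; rewrite lee_fin !mulr_ge0 // powR_ge0.
- apply/measurable_EFinP; apply: measurable_funM => //.
  by apply: measurable_funM => //; exact: measurable_indic.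
- by move=> x _; rewrite lee_fin mulr_ge0 // powR_ge0.
- exact/measurable_EFinP.
Qed.

(** The domination inequality is used twice with the same right-hand integral: over the cubes, to
    bound that integral by absorption, and then over the tents. *)
Lemma finite_max_strong_type s : laminar Q U s ->
  \int[mu]_z (finite_max s weighted_average U z `^ r * om z)%:E <=
  (B * (2 * (2 * (r / (r - 1))) `^ r * H))%:E.
Proof.
move=> ls; set c := weighted_average.
have c0 := weighted_average_ge0; have cV := weighted_averageE.
have r1' := r1; have [a aE] : exists a, (a = r / (r - 1))%R by eexists.
rewrite -aE; have a0 : (0 < a)%R by rewrite aE; apply: divr_gt0; lra.
have hv0 x : (0 <= h x * v x)%R by rewrite mulr_ge0.
have mM q (g : T -> R) : measurable_fun [set: T] g ->
    measurable_fun [set: T] (fun x => finite_max s c Q x `^ q * g x)%R.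
  move=> mg; apply: measurable_funM => //.
  exact: measurableT_comp (measurable_powR _) (measurable_finite_max _ _ mQ).
have H0 : (0 <= H)%R.
  rewrite -lee_fin (le_trans _ hH) // integral_ge0 // => x _.
  by rewrite lee_fin mulr_ge0 // powR_ge0.
have [S SE] : exists S, \int[lam]_x (finite_max s c Q x `^ r * v x)%:E = S%:E.
  exists (fine (\int[lam]_x (finite_max s c Q x `^ r * v x)%:E)).
  rewrite fineK // ge0_fin_numE; first exact: finite_max_integral_lty.
  by apply: integral_ge0 => x _; rewrite lee_fin mulr_ge0 // powR_ge0.
have half : a%:E * \int[lam]_x (finite_max s c Q x `^ (r - 1) * (h x * v x))%:E <=
    (2^-1 * S + (2 * a) `^ r * H)%:E.
  rewrite -ge0_integralZl_EFin //; first last.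
  - exact: ltW.
  - by apply/measurable_EFinP; exact: mM.
  - by move=> x _; rewrite lee_fin mulr_ge0 // powR_ge0.
  apply: (@le_trans _ _ (\int[lam]_x ((2^-1)%:E * (finite_max s c Q x `^ r * v x)%:E +
      ((2 * a) `^ r)%:E * (h x `^ r * v x)%:E))).
    apply: ge0_le_integral_nonmeasurable => x *.
    - by rewrite -EFinM lee_fin mulr_ge0 ?(ltW a0) // mulr_ge0 ?powR_ge0.
    - by rewrite -!EFinM -EFinD lee_fin addr_ge0 // !mulr_ge0 ?powR_ge0 // invr_ge0.
    - rewrite -!EFinM -EFinD lee_fin !mulrA -mulrDl ler_wpM2r //.
      rewrite (_ : _ * _ * h x = a * h x * finite_max s c Q x `^ (r - 1))%R; last by ring.
      by apply: young_crude => //; exact: finite_max_ge0.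
  rewrite ge0_integralD //.
  - rewrite !ge0_integralZl_EFin ?powR_ge0 ?invr_ge0 //.
    + by rewrite EFinD SE (EFinM (_ `^ _)) leeD // lee_wpmul2l // lee_fin powR_ge0.
    + by move=> x _; rewrite lee_fin mulr_ge0 // powR_ge0.
    + exact/measurable_EFinP.
    + by move=> x _; rewrite lee_fin mulr_ge0 // powR_ge0.
    + by apply/measurable_EFinP; exact: mM.
  - by move=> x _; rewrite -EFinM lee_fin !mulr_ge0 ?powR_ge0 // invr_ge0.
  - by apply/measurable_EFinP/measurable_funM => //; exact: mM.
  - by move=> x _; rewrite -EFinM lee_fin !mulr_ge0 ?powR_ge0.
  - by apply/measurable_EFinP/measurable_funM.
(* The cubes serve as tents here, with constant 1, and give [S <= S / 2 + (2 * a) ^ r * H] with [S]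
   finite. *)
have SH : (S <= 2 * (2 * a) `^ r * H)%R.
  have : S%:E <= (2^-1 * S + (2 * a) `^ r * H)%:E.
    apply: le_trans half; rewrite -SE -[X in X%:E * _]mul1r.
    rewrite aE; apply: (finite_max_integral_le (V := V)) => //.
    - by move=> k; rewrite mul1r vV.
    - exact: laminar_diag ls.
  by rewrite lee_fin; lra.
apply: (@le_trans _ _ (B%:E * (2^-1 * S + (2 * a) `^ r * H)%:E)).
  apply: le_trans (lee_wpmul2l _ half); last by rewrite lee_fin.
  rewrite muleA -EFinM aE; exact: (finite_max_integral_le (V := V)).
by rewrite -EFinM lee_fin ler_wpM2l //; lra.
Qed.

End strong_type.
End finite_maximal_function.

(** * Shifted dyadic grids *)

Section shifted_grids.
Context {R : realType}.

(** The shift is common and [s2] is an integer multiple of [s1], so end points of the coarse grid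
    belong to the fine one. The common point [x] gives strict inequalities between integers, which
    sharpen to [j2 * 2 ^ e <= j1] and [j1 + 1 <= (j2 + 1) * 2 ^ e]. *)
Lemma grid_nested (s1 s2 t x y : R) (e : nat) (j1 j2 : int) : 0 < s1 ->
  s2 = s1 * 2 ^+ e ->
  s1 * j1%:~R + t <= x < s1 * j1%:~R + t + s1 ->
  s2 * j2%:~R + t <= x < s2 * j2%:~R + t + s2 ->
  s1 * j1%:~R + t <= y < s1 * j1%:~R + t + s1 ->
  s2 * j2%:~R + t <= y < s2 * j2%:~R + t + s2.
Proof.
move=> s0 -> /andP[x1 x2] /andP[x3 x4] /andP[y1 y2].
have lo : j2 * 2 ^+ e <= j1.
  rewrite -ltzD1 -(ltr_int R) rmorphD rmorphM rmorphXn /= -(ltr_pM2l s0) mulrDr mulr1.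
  by rewrite mulrCA mulrA mulrC mulrA; nra.
have hi : j1 + 1 <= (j2 + 1) * 2 ^+ e.
  rewrite lezD1 -(ltr_int R) rmorphM rmorphD rmorphXn /= -(ltr_pM2l s0).
  by nra.
have {}lo : s1 * (j2%:~R * 2 ^+ e) <= s1 * j1%:~R.
  by move: lo; rewrite -(ler_int R) rmorphM rmorphXn /= ler_pM2l.
have {}hi : s1 * (j1%:~R + 1) <= s1 * ((j2%:~R + 1) * 2 ^+ e).
  by move: hi; rewrite -(ler_int R) rmorphM !rmorphD rmorphXn /= ler_pM2l.
by apply/andP; split; nra.
Qed.

(* The one-third trick: since 3 does not divide [2 ^ l], the end points of the two
   grids of step [s] are at distance at least [s / 3] from each other. *)
Lemma grid_cover (c d s : R) (l : nat) : 0 < s -> 0 <= d -> 3 * d < s ->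
  exists (a : bool) (j : int),
    [/\ s * j%:~R + a%:R * (s * 2 ^+ l / 3) <= c,
        c + d < s * j%:~R + a%:R * (s * 2 ^+ l / 3) + s &
        `|j|%:~R <= `|c| / s + 2 ^+ l + 1].
Proof.
move=> s0 d0 ds; pose u := c / s; pose e := d / s.
have cE : c = s * u by rewrite /u mulrC mulfVK // gt_eqF.
have dE : d = s * e by rewrite /e mulrC mulfVK // gt_eqF.
have e0 : 0 <= e by rewrite divr_ge0 // ltW.
have e3 : 3 * e < 1 by move: ds; rewrite dE mulrCA -{2}(mulr1 s) ltr_pM2l.
have -> : `|c| / s = `|u| by rewrite cE normrM (gtr0_norm s0) mulrAC divff ?mul1r // gt_eqF.
have /andP[] := Num.Theory.floor_itv u; set j0 := Num.floor u.
rewrite rmorphD /= => ju uj.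
have abs_j0 : `|j0%:~R| <= `|u| + 1 :> R.
  by rewrite ler_norml; have := ler_norm u; have := ler_norm (- u); rewrite normrN; lra.
(* Either the unshifted interval starting at [j0] already contains the segment, or the segment
   reaches [j0 + 1] and hence starts beyond [j0 + 2/3]. *)
have [ue|ue] := ltP (u + e) (j0%:~R + 1).
  exists false, j0; rewrite !mul0r addr0 cE dE; split.
  - by rewrite ler_pM2l.
  - by rewrite -mulrDr -{3}(mulr1 s) -mulrDr ltr_pM2l.
  - rewrite intr_norm (le_trans abs_j0) // -addrA lerD2l lerDr exprn_ge0 //.
pose q := (2 ^ l %/ 3)%N; pose r := (2 ^ l %% 3)%N.
have qr : 2 ^+ l = 3 * q%:R + r%:R :> R.
  by rewrite -natrX (divn_eq (2 ^ l) 3) natrD natrM mulrC.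
have r12 : (0 < r < 3)%N.
  rewrite ltn_mod andbT lt0n -/(dvdn 3 (2 ^ l)) Euclid_dvdX //.
(* In units of [s] the shift is [q + r / 3], so this interval starts at [j0 + r / 3] with [r] equal
   to 1 or 2. *)
exists true, (j0 - q%:Z); rewrite mul1r cE dE rmorphB /= -pmulrn.
have r1 : 1 <= r%:R :> R by rewrite (ler_nat _ 1); case/andP: r12.
have r2 : r%:R <= 2 :> R by rewrite (ler_nat _ _ 2) -ltnS; case/andP: r12.
have q0 : 0 <= q%:R :> R by [].
have lhs : s * (j0%:~R - q%:R) + s * 2 ^+ l / 3 = s * (j0%:~R + r%:R / 3).
  by rewrite qr; field.
rewrite lhs; split.
- by rewrite ler_pM2l //; lra.
- by rewrite -mulrDr -{3}(mulr1 s) -mulrDr ltr_pM2l //; lra.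
- rewrite intr_norm rmorphB /= -pmulrn (le_trans (ler_normB _ _)) // (ger0_norm q0) qr.
  by lra.
Qed.

(** The largest [l] with [3 * d < 2 ^ N / 2 ^ l] works: failure at [l + 1] is the upper bound, and
    the last hypothesis keeps [l] below [2 * N]. *)
Lemma grid_scale (d : R) (N : nat) : 0 < d -> 3 * d < 2 ^+ N -> 1 <= 2 ^+ N * (3 * d) ->
  exists2 l : nat, (l <= 2 * N)%N &
    3 * d < 2 ^+ N / 2 ^+ l /\ 2 ^+ N / 2 ^+ l <= 6 * d.
Proof.
move=> d0 dN Nd; pose P l := 3 * d < 2 ^+ N / 2 ^+ l.
have e20 k : 0 < 2 ^+ k :> R by rewrite exprn_gt0.
have P0 : exists l, P l by exists 0%N; rewrite /P expr0 divr1.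
have Pub l : P l -> (l <= 2 * N)%N.
  rewrite /P ltr_pdivlMr // => Pl; rewrite leqNgt; apply/negP => Nl.
  have : 2 ^+ (2 * N) <= 2 ^+ l :> R by rewrite ler_eXn2l ?ltr1n // ltnW.
  rewrite mul2n -addnn exprD => H.
  have : 3 * d * (2 ^+ N * 2 ^+ N) <= 3 * d * 2 ^+ l by rewrite ler_pM2l //; lra.
  rewrite mulrA (mulrC (3 * d)); have := e20 N; nra.
case: (ex_maxnP P0 Pub) => l Pl lmax; exists l; first exact: Pub.
split => //; have : ~~ P l.+1 by apply/negP => /lmax; rewrite ltnn.
rewrite /P -leNgt exprS invfM mulrCA => H; lra.
Qed.

End shifted_grids.

(** * Cubes and tents of the shifted grids *)

Section dyadic_cubes.
Context {R : realType} {n : nat}.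

(* [k = (l, j)] is the level [l] and the position [j] of the cube, whose side
   is [2 ^ (N - l)]; the whole grid is shifted by [2 ^ N / 3] in the directions
   selected by [a]. *)
Definition grid_index := (nat * {ffun 'I_n -> int})%type.

Implicit Types (N : nat) (a : {ffun 'I_n -> bool}) (k : grid_index).

Definition grid_side N k : R := 2 ^+ N / 2 ^+ k.1.

Lemma grid_side_gt0 N k : 0 < grid_side N k.
Proof. by rewrite divr_gt0 // exprn_gt0. Qed.

Definition grid_corner N a k (i : 'I_n) : R :=
  grid_side N k * (k.2 i)%:~R + (a i)%:R * (2 ^+ N / 3).

(** Half-open, so that cubes of one level are disjoint. *)
Definition grid_cube N a k : set (n.-tuple R) :=
  box (fun i => `[grid_corner N a k i, grid_corner N a k i + grid_side N k[%classic : set R).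

Definition grid_tent N a k : set (n.-tuple R * R) :=
  [set z | grid_cube N a k z.1 /\ 0 <= z.2 < grid_side N k].

(** The suprema defining the two constants range over closed cubes; their bounds reach a grid cube
    through its closure. *)
Definition grid_closure N a k : cube R n :=
  Cube [tuple grid_corner N a k i | i < n] (PosNum (grid_side_gt0 N k)).

Lemma cube_set_box (Q : cube R n) : cube_set Q =
  box (fun i => `[tnth (corner Q) i, tnth (corner Q) i + (side Q)%:num]%classic : set R).
Proof. by apply/seteqP; split => x /= Qx i; have := Qx i; rewrite /= in_itv. Qed.

Lemma measurable_cube_set (Q : cube R n) : measurable (cube_set Q).
Proof. by rewrite cube_set_box; apply: measurable_box => i; exact: measurable_itv. Qed.

Lemma measurable_tent (Q : cube R n) : measurable (tent Q).
Proof.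
rewrite (_ : tent _ = cube_set Q `*` `[0, (side Q)%:num[%classic).
  by apply: measurableX; [exact: measurable_cube_set|exact: measurable_itv].
by apply/seteqP; split => z /=; rewrite in_itv.
Qed.

Lemma lebesgue_cube_set (Q : cube R n) :
  lebesgue_measure_Rn (cube_set Q) = ((side Q)%:num ^+ n)%:E.
Proof.
rewrite cube_set_box lebesgue_measure_Rn_box; last by move=> i; exact: measurable_itv.
rewrite (eq_bigr (fun=> (side Q)%:num%:E)).
  by rewrite prodEFin prodr_const card_ord.
by move=> i _; rewrite lebesgue_measure_itv /= lte_fin ltrDl gt0 -EFinB addrAC subrr add0r.
Qed.

Lemma measurable_grid_cube N a k : measurable (grid_cube N a k).
Proof. by apply: measurable_box => i; exact: measurable_itv. Qed.

Lemma lebesgue_grid_cube N a k :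
  lebesgue_measure_Rn (grid_cube N a k) = (grid_side N k ^+ n)%:E.
Proof.
rewrite lebesgue_measure_Rn_box; last by move=> i; exact: measurable_itv.
rewrite (eq_bigr (fun=> (grid_side N k)%:E)).
  by rewrite prodEFin prodr_const card_ord.
move=> i _; rewrite lebesgue_measure_itv /= lte_fin ltrDl grid_side_gt0.
by rewrite -EFinB addrAC subrr add0r.
Qed.

Lemma measurable_grid_tent N a k : measurable (grid_tent N a k).
Proof.
rewrite (_ : grid_tent N a k = grid_cube N a k `*` `[0, grid_side N k[%classic).
  by apply: measurableX; [exact: measurable_grid_cube|exact: measurable_itv].
by apply/seteqP; split => z /=; rewrite in_itv.
Qed.

Lemma grid_cube_closure N a k : grid_cube N a k `<=` cube_set (grid_closure N a k).
Proof.
move=> x Qx i; have := Qx i; rewrite /= in_itv /= tnth_mktuple => /andP[-> /ltW ->] //.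
Qed.

Lemma grid_tent_closure N a k : grid_tent N a k `<=` tent (grid_closure N a k).
Proof. by move=> z [/grid_cube_closure Qz zs]; split. Qed.

Local Open Scope ereal_scope.

(** Both cubes have the same finite volume, so the faces in between form a null set. *)
Lemma integral_grid_closure N a k (g : n.-tuple R -> R) :
  measurable_fun [set: n.-tuple R] g -> (forall x, (0 <= g x)%R) ->
  \int[lebesgue_measure_Rn]_(x in cube_set (grid_closure N a k)) (g x)%:E =
  \int[lebesgue_measure_Rn]_(x in grid_cube N a k) (g x)%:E.
Proof.
move=> mg g0; have mQ := measurable_cube_set (grid_closure N a k).
have mG := measurable_grid_cube N a k; have sub := @grid_cube_closure N a k.
have null : lebesgue_measure_Rn (cube_set (grid_closure N a k) `\` grid_cube N a k) = 0.
  have -> : forall A B : set (n.-tuple R), measurable A -> measurable B ->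
      lebesgue_measure_Rn A < +oo -> lebesgue_measure_Rn (A `\` B) =
      lebesgue_measure_Rn A - lebesgue_measure_Rn (A `&` B) by exact: measureD.
    by rewrite setIidr // lebesgue_cube_set lebesgue_grid_cube -EFinB subrr.
  all: rewrite ?lebesgue_cube_set ?ltry //.
rewrite -{1}(setDUK sub) ge0_integral_setU //.
- rewrite [X in _ + X](_ : _ = 0) ?adde0 //.
  apply: null_set_integral => //; first exact: measurableD.
  by apply/measurable_EFinP; exact: measurable_funTS.
- exact: measurableD.
- by rewrite setDUK //; apply/measurable_EFinP; exact: measurable_funTS.
- by move=> x _; rewrite lee_fin.
- by apply/disj_setPS => x [? []].
Qed.

Local Close Scope ereal_scope.

(** A common point makes the cubes nested in every coordinate, and the inner tent is lower because
    the inner side is shorter. *)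
Lemma grid_cube_laminar N a k1 k2 : (k2.1 <= k1.1)%N ->
  (grid_cube N a k1 `<=` grid_cube N a k2 /\ grid_tent N a k1 `<=` grid_tent N a k2) \/
  grid_cube N a k1 `&` grid_cube N a k2 = set0.
Proof.
move=> k21; have [->|/set0P[x [x1 x2]]] := eqVneq (grid_cube N a k1 `&` grid_cube N a k2) set0.
  by right.
left; have sE : grid_side N k2 = grid_side N k1 * 2 ^+ (k1.1 - k2.1).
  rewrite /grid_side -(subnK k21) exprD addnK.
  by field; rewrite !expf_neq0.
have QQ : grid_cube N a k1 `<=` grid_cube N a k2.
  move=> y y1 i; have := y1 i; have := x1 i; have := x2 i; rewrite /= !in_itv /=.
  by move=> H2 H1; apply: (grid_nested (grid_side_gt0 N k1) sE H1 H2).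
split => // z [/QQ Qz /andP[z0 zs]]; split => //; rewrite z0 /= (lt_le_trans zs) //.
by rewrite sE ler_peMr ?(ltW (grid_side_gt0 _ _)) // exprn_ege1 // ler1n.
Qed.

(** Sides run from [2 ^ N] down to [2 ^ (- N)] and positions over [[- 3 * 4 ^ N, 3 * 4 ^ N]]. The
    sort puts the smallest cubes first, as [laminar] demands. *)
Definition grid_list N : seq grid_index :=
  sort (fun k1 k2 => (k2.1 <= k1.1)%N)
    [seq (l, [ffun i => (g i : nat)%:Z - (3 * 4 ^ N)%N%:Z]) |
      l : nat <- iota 0 (2 * N).+1, g : {ffun 'I_n -> 'I_(6 * 4 ^ N).+1} <- enum {: {ffun 'I_n -> 'I_(6 * 4 ^ N).+1}}].

Lemma mem_grid_list N k : (k.1 <= 2 * N)%N ->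
  (forall i, `|k.2 i| <= (3 * 4 ^ N)%N%:Z) -> k \in grid_list N.
Proof.
move=> kl kj; rewrite mem_sort; apply/allpairsP.
have lt i : (`|(k.2 i + (3 * 4 ^ N)%N%:Z)%R| < (6 * 4 ^ N).+1)%N.
  by have := kj i; lia.
exists (k.1, [ffun i => Ordinal (lt i)]); split.
- by rewrite mem_iota add0n ltnS.
- by rewrite mem_enum.
- case: k kl kj lt => l j /= kl kj lt; congr pair; apply/ffunP => i; rewrite !ffunE /=.
  by have := kj i; lia.
Qed.

Lemma laminar_grid_list N a : laminar (grid_cube N a) (grid_tent N a) (grid_list N).
Proof.
have tot : total (fun k1 k2 : grid_index => (k2.1 <= k1.1)%N).
  by move=> k1 k2; exact: leq_total.
have trans : transitive (fun k1 k2 : grid_index => (k2.1 <= k1.1)%N).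
  by move=> k1 k2 k3 h1 h2; exact: leq_trans h1.
rewrite /grid_list; move: [seq _ | _ <- _, _ <- _] => s0; have := sort_sorted tot s0.
elim: (sort _ _) => // k s ih /= pks; split; last exact/ih/path_sorted/pks.
move=> k' k's; apply: grid_cube_laminar.
by have /allP/(_ _ k's) := order_path_min trans pks.
Qed.

(** The one-third trick is applied in each coordinate separately, which selects the direction set
    [a]; all coordinates share one level. *)
Lemma grid_list_cover (Q : cube R n) : exists N0, forall N, (N0 <= N)%N ->
  exists a k, [/\ k \in grid_list N, cube_set Q `<=` grid_cube N a k,
    3 * (side Q)%:num < grid_side N k & grid_side N k <= 6 * (side Q)%:num].
Proof.
have : 0 < (side Q)%:num by [].
set d := (side Q)%:num => d0.
(* Once [2 ^ N] exceeds [M], the scale of [Q] lies within the available levels and its corner within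
   the available positions. *)
pose M := 3 * d + (3 * d)^-1 + \sum_i `|tnth (corner Q) i|.
exists (Num.truncn M).+1 => N MN.
have {}MN : M < 2 ^+ N.
  apply: (lt_le_trans (Num.Theory.truncnS_gt M)); rewrite -natrX ler_nat (leq_trans MN) //.
  exact/ltnW/ltn_expl.
have S0 : 0 <= \sum_i `|tnth (corner Q) i| by rewrite sumr_ge0.
have d30 : 0 < 3 * d by lra.
have id30 : 0 < (3 * d)^-1 by rewrite invr_gt0.
have [l l2N [dl ld]] : exists2 l : nat, (l <= 2 * N)%N &
    3 * d < 2 ^+ N / 2 ^+ l /\ 2 ^+ N / 2 ^+ l <= 6 * d.
  apply: grid_scale => //; first by move: MN; rewrite /M; lra.
  have : 1 < 2 ^+ N * (3 * d) by rewrite -ltr_pdivrMr // div1r; move: MN; rewrite /M; lra.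
  exact: ltW.
pose s := 2 ^+ N / 2 ^+ l : R.
have s0 : 0 < s by rewrite divr_gt0 // exprn_gt0.
have sN : s * 2 ^+ l = 2 ^+ N by rewrite /s mulfVK // expf_neq0.
pose good i (t : bool * int) := [/\ s * t.2%:~R + t.1%:R * (s * 2 ^+ l / 3) <= tnth (corner Q) i,
  tnth (corner Q) i + d < s * t.2%:~R + t.1%:R * (s * 2 ^+ l / 3) + s &
  `|t.2|%:~R <= `|tnth (corner Q) i| / s + 2 ^+ l + 1].
have /choice[t tP] i : exists t, good i t.
  by have [a [j aj]] := grid_cover (tnth (corner Q) i) l s0 (ltW d0) dl; exists (a, j).
exists [ffun i => (t i).1], (l, [ffun i => (t i).2]); split => //.
(* The position is at most [2 ^ l + 2 ^ l + 1], and each of these terms is at most [4 ^ N]. *)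
- apply: mem_grid_list => // i; rewrite ffunE; have [_ _ ] := tP i.
  rewrite -(ler_int R) => /le_trans; apply; rewrite -pmulrn natrM natrX.
  have -> : 4 ^+ N = 2 ^+ N * 2 ^+ N :> R by rewrite -exprMn; congr (_ ^+ _); ring.
  have ci : `|tnth (corner Q) i| / s <= 2 ^+ l.
    rewrite ler_pdivrMr // mulrC sN (le_trans _ (ltW MN)) // /M.
    by rewrite (bigD1 i) //= ler_wpDl ?lerDl ?sumr_ge0 // addr_ge0 // ltW.
  have l2 : 2 ^+ l <= 2 ^+ N * 2 ^+ N :> R.
    by rewrite -exprD ler_eXn2l ?ltr1n // addnn -mul2n.
  have : 1 <= 2 ^+ l :> R by rewrite exprn_ege1 // ler1n.
  by lra.
- move=> x Qx i; have [t1 t2 _] := tP i; have /andP[x1 x2] := Qx i.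
  rewrite /= in_itv /= /grid_corner /grid_side /= !ffunE -/s -sN.
  by rewrite (le_trans t1 x1) /= (le_lt_trans x2).
Qed.

End dyadic_cubes.

Local Open Scope ereal_scope.

(** * The multilinear estimate on a finite family *)

Section multilinear_laminar.
Context {R : realType} {K : eqType} {m : nat}.
Context d (T : measurableType d) d' (Z : measurableType d').
Variables (lam : {measure set T -> \bar R}) (mu : {measure set Z -> \bar R}).
Variables (Q : K -> set T) (U : K -> set Z).
Variables (p pb A B : R) (P : 'I_m -> R) (w f : 'I_m -> T -> R) (N : 'I_m -> R).
Variables (Vol V : K -> R) (S : 'I_m -> K -> R).
Local Notation q i := (conjugate (P i)).
Local Notation sigma i := (fun x => w i x `^ (1 - q i))%R.
Local Notation v := (fun x => \prod_(i < m) w i x `^ (p / P i))%R.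

Hypotheses (m0 : (0 < m)%N) (p0 : (0 < p)%R) (P1 : forall i, (1 < P i)%R).
Hypothesis (pE : (p^-1 = \sum_(i < m) (P i)^-1)%R).
Hypotheses (pb1 : (1 < pb)%R) (qpb : forall i, (q i <= pb)%R).
Hypotheses (A0 : (0 <= A)%R) (B0 : (0 <= B)%R).
Hypotheses (mQ : forall k, measurable (Q k)) (mU : forall k, measurable (U k)).
Hypotheses (mw : forall i, measurable_fun [set: T] (w i)).
Hypotheses (mf : forall i, measurable_fun [set: T] (f i)).
Hypotheses (w0 : forall i x, (0 < w i x)%R) (f0 : forall i x, (0 <= f i x)%R).
Hypotheses (Vol0 : forall k, (0 < Vol k)%R) (V0 : forall k, (0 < V k)%R).
Hypothesis S0 : forall i k, (0 < S i k)%R.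
Hypothesis QVol : forall k, lam (Q k) = (Vol k)%:E.
Hypothesis QV : forall k, \int[lam]_(x in Q k) (v x)%:E = (V k)%:E.
Hypothesis QS : forall i k, \int[lam]_(x in Q k) (sigma i x)%:E = (S i k)%:E.
Hypothesis AP : forall k,
  ((V k / Vol k) `^ p^-1 * \prod_(i < m) (S i k / Vol k) `^ (q i)^-1 <= A)%R.
Hypothesis UV : forall k, mu (U k) <= (B * V k)%:E.
Hypothesis fN : forall i, \int[lam]_x (f i x `^ P i * w i x)%:E <= (N i)%:E.

Definition maximal_const (r : R) : R := (2 * (2 * (r / (r - 1))) `^ r)%R.

Definition multilinear_const : R :=
  (maximal_const pb * \prod_(i < m) maximal_const (P i) `^ (p / P i))%R.

Definition laminar_average k : R := (\prod_(i < m) (fine (\int[lam]_(x in Q k) (f i x)%:E) / Vol k))%R.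

(** This is [f i / sigma i]. *)
Let g i x := (f i x * w i x `^ (q i - 1))%R.

Let msigma i : measurable_fun [set: T] (sigma i).
Proof. exact: measurableT_comp (measurable_powR _) (mw i). Qed.

Let mv : measurable_fun [set: T] v.
Proof. by apply: measurable_prod => i _; exact: measurableT_comp (measurable_powR _) (mw i). Qed.

Let sigma0 i x : (0 <= sigma i x)%R. Proof. exact: powR_ge0. Qed.

Let v0 x : (0 <= v x)%R. Proof. by apply: prodr_ge0 => i _; exact: powR_ge0. Qed.

Let mg i : measurable_fun [set: T] (g i).
Proof. by apply: measurable_funM => //; exact: measurableT_comp (measurable_powR _) (mw i). Qed.

Let g0 i x : (0 <= g i x)%R.
Proof. by rewrite mulr_ge0 ?powR_ge0. Qed.

Let gN i : \int[lam]_x (g i x `^ P i * sigma i x)%:E <= (N i)%:E.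
Proof.
apply: le_trans (fN i); rewrite le_eqVlt; apply/orP; left; apply/eqP.
by apply: eq_integral => x _; rewrite dual_weight_norm.
Qed.

Let s i := weighted_average lam Q (S i) (sigma i) (g i).

Let s0 i k : (0 <= s i k)%R.
Proof. exact: weighted_average_ge0. Qed.

Let sE i k : \int[lam]_(x in Q k) (f i x)%:E = (s i k * S i k)%:E.
Proof.
rewrite -(weighted_averageE (H := N i) (r := P i)) //.
by apply: eq_integral => x _; rewrite dual_weight_cancel.
Qed.

Lemma laminar_integral_fin i k : \int[lam]_(x in Q k) (f i x)%:E \is a fin_num.
Proof. by rewrite sE. Qed.

Let Q0 k : Q k !=set0.
Proof.
apply/set0P/eqP => Qk0; have := Vol0 k.
by rewrite -lte_fin -QVol Qk0 measure0 ltxx.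
Qed.

Variable l : seq K.
Hypothesis lam_l : laminar Q U l.

Let M i := finite_max l (s i) Q.

Let M0 i x : (0 <= M i x)%R. Proof. exact: finite_max_ge0. Qed.

Let mM i : measurable_fun [set: T] (M i).
Proof. exact: measurable_finite_max. Qed.

(** The maximal theorem for the measure [sigma i * lam], with the cubes themselves as tents and
    constant 1. *)
Let MN i : \int[lam]_x (M i x `^ P i * sigma i x)%:E <= (maximal_const (P i) * N i)%:E.
Proof.
rewrite -[X in X%:E]mul1r.
apply: (finite_max_strong_type (V := S i)) => //.
- by move=> k; rewrite mul1r QS.
- exact: laminar_diag lam_l.
Qed.

Let h x := (\prod_(i < m) (M i x * sigma i x) `^ (p / pb))%R.

Let h0 x : (0 <= h x)%R. Proof. by apply: prodr_ge0 => i _; exact: powR_ge0. Qed.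

Let mh : measurable_fun [set: T] h.
Proof.
apply: measurable_prod => i _; apply: (measurableT_comp (measurable_powR _)).
exact: measurable_funM.
Qed.

Let pb0 : pb != 0%R. Proof. by rewrite gt_eqF // (lt_trans ltr01). Qed.

Let hN : \int[lam]_x (h x `^ pb * v x)%:E <=
  (\prod_(i < m) (maximal_const (P i) * N i) `^ (p / P i))%:E.
Proof.
rewrite (eq_integral (fun x => (\prod_(i < m) (M i x `^ P i * sigma i x) `^ (p / P i))%:E)).
  apply: integral_prod_powR_le => //.
  - by move=> i; rewrite divr_ge0 ?(ltW p0) // ltW // (lt_trans ltr01).
  - by rewrite -mulr_sumr -pE divff // gt_eqF.
  - by move=> i x; rewrite mulr_ge0 ?powR_ge0.
  - by move=> i; apply: measurable_funM => //; exact: measurableT_comp (measurable_powR _) (mM i).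
move=> x _; rewrite powR_prod; last by move=> i; exact: powR_ge0.
by rewrite -big_split /=; congr EFin; apply: eq_bigr => i _; rewrite dual_weight_split.
Qed.

Let c := weighted_average lam Q V v h.

Let c0 k : (0 <= c k)%R.
Proof. exact: weighted_average_ge0. Qed.

Let cE k : \int[lam]_(x in Q k) (h x * v x)%:E = (c k * V k)%:E.
Proof. by apply: (weighted_averageE (r := pb)) => //; exact: hN. Qed.

(** Hoelder's inequality on [Q k] for the [m + 1] functions [h * v] and [sigma i]. Its left
    integrand is at least the product of the [s i k ^ (1 / kap)], because [M i >= s i k] on
    [Q k]. *)
Let pointwise k : k \in l -> (laminar_average k <= A `^ pb * c k `^ (pb / p))%R.
Proof.
move=> kl; pose kap := (m%:R * (pb - 1))%R.
have kap0 : (0 < kap)%R by rewrite mulr_gt0 ?ltr0n // subr_gt0.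
rewrite /laminar_average; under eq_bigr do rewrite sE /=.
apply: (@le_trans _ _ (((V k / Vol k) `^ p^-1 *
    \prod_i (S i k / Vol k) `^ (q i)^-1) `^ pb * c k `^ (pb / p))%R); last first.
  apply: ler_wpM2r; first exact: powR_ge0.
  apply: ge0_ler_powR (AP k); rewrite ?nnegrE ?(ltW (lt_trans ltr01 pb1)) //.
  by apply: mulr_ge0; [exact: powR_ge0|apply: prodr_ge0 => i _; exact: powR_ge0].
apply: product_average_le => //.
rewrite -/kap -lee_fin EFinM -QVol muleC -integral_cst //.
(* Index 0 stands for [h * v], the other indices for the [sigma i]. *)
pose t (j : 'I_m.+1) := if unlift ord0 j is Some i then ((pb / q i - 1) / kap)%R
  else (pb / p / kap)%R.
pose F (j : 'I_m.+1) x := if unlift ord0 j is Some i then sigma i x else (h x * v x)%R.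
pose b (j : 'I_m.+1) := if unlift ord0 j is Some i then S i k else (c k * V k)%R.
have t0E : t ord0 = (pb / p / kap)%R by rewrite /t unlift_none.
have tE i : t (lift ord0 i) = ((pb / q i - 1) / kap)%R by rewrite /t liftK.
have F0E : F ord0 = (fun x => h x * v x)%R by apply/funext => x; rewrite /F unlift_none.
have FE i : F (lift ord0 i) = sigma i by apply/funext => x; rewrite /F liftK.
have bE : (\prod_j b j `^ t j)%R =
    ((c k * V k) `^ (pb / p / kap) * \prod_i S i k `^ ((pb / q i - 1) / kap))%R.
  rewrite big_ord_recl t0E /b unlift_none; congr (_ * _)%R.
  by apply: eq_bigr => i _; rewrite liftK tE.
rewrite -bE; apply: (@le_trans _ _ (\int[lam]_(x in Q k) (\prod_j F j x `^ t j)%:E)).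
  apply: ge0_le_integral_nonmeasurable => x *.
  + by rewrite lee_fin; apply: prodr_ge0 => i _; exact: powR_ge0.
  + by rewrite lee_fin; apply: prodr_ge0 => i _; exact: powR_ge0.
  + rewrite lee_fin big_ord_recl t0E F0E.
    under [X in (_ <= _ * X)%R]eq_bigr do rewrite tE FE.
    have -> : (h x * v x = \prod_i ((M i x * sigma i x) `^ (p / pb) * w i x `^ (p / P i)))%R.
      by rewrite big_split.
    rewrite powR_prod; last by move=> i; rewrite mulr_ge0 ?powR_ge0.
    rewrite -big_split /=; apply: ler_prod => i _; rewrite powR_ge0 /=.
    rewrite dual_weight_interpolate ?(gt_eqF kap0) ?(gt_eqF p0) //.
    apply: ge0_ler_powR; rewrite ?nnegrE ?invr_ge0 ?(ltW kap0) //.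
    exact: le_finite_max.
apply: integral_prod_powR_le => //.
(* The exponents of the [sigma i] are nonnegative because [q i <= pb]. *)
- move=> j; rewrite /t; case: unliftP => [i _|_]; last first.
    by rewrite !divr_ge0 ?(ltW kap0) ?(ltW p0) // (ltW (lt_trans ltr01 pb1)).
  rewrite divr_ge0 ?(ltW kap0) // subr_ge0 ler_pdivlMr ?mul1r //.
  exact: lt_trans (conjugate_gt1 (P1 i)).
(* Their sum is 1, since [pb / p] plus all [pb / q i - 1] is [m * pb - m = kap]. *)
- rewrite big_ord_recl t0E; under eq_bigr do rewrite tE.
  rewrite -mulr_suml sumrB -mulr_sumr sumr_const card_ord.
  under eq_bigr do rewrite conjugate_inv //.
  rewrite sumrB sumr_const card_ord -pE /kap; field.
  by rewrite subr_eq0 gt_eqF ?(gt_eqF p0) ?pnatr_eq0 -?lt0n ?m0.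
- by move=> j x; rewrite /F; case: unliftP => [i _|_]; rewrite ?powR_ge0 // mulr_ge0.
- move=> j; apply: measurable_funTS; rewrite /F; case: unliftP => [i _|_]; first exact: msigma.
  exact: measurable_funM.
- move=> j; rewrite /F /b; case: unliftP => [i _|_]; first by rewrite QS.
  by rewrite cE.
Qed.

(** The pointwise bound replaces the [p]-th power by the [pb]-th power of the maximal function of
    the [v]-averages of [h] over tents; the maximal theorem with [om = 1] then reduces it to the
    norm of [h]. *)
Lemma multilinear_laminar_bound :
  \int[mu]_z (finite_max l laminar_average U z `^ p)%:E <=
  (multilinear_const * B * A `^ (p * pb) * \prod_(i < m) N i `^ (p / P i))%:E.
Proof.
have N0 i : (0 <= N i)%R.
  rewrite -lee_fin (le_trans _ (fN i)) // integral_ge0 // => x _.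
  by rewrite lee_fin mulr_ge0 ?powR_ge0 // ltW.
have mc0 r : (1 < r)%R -> (0 <= maximal_const r)%R.
  by move=> r1; rewrite mulr_ge0 // powR_ge0.
have pw z : (finite_max l laminar_average U z `^ p <=
    A `^ (p * pb) * (finite_max l c U z `^ pb * 1))%R.
  have M'0 := finite_max_ge0 l c U z.
  have -> : (A `^ (p * pb) * (finite_max l c U z `^ pb * 1) =
      (A `^ pb * finite_max l c U z `^ (pb / p)) `^ p)%R.
    rewrite mulr1 powRM ?powR_ge0 // -!powRrM mulfVK ?(gt_eqF p0) //.
    by rewrite (mulrC p).
  apply: ge0_ler_powR; rewrite ?nnegrE ?finite_max_ge0 ?mulr_ge0 ?powR_ge0 ?(ltW p0) //.
  apply: finite_max_le => [|k kl Uz]; first by rewrite mulr_ge0 ?powR_ge0.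
  apply: le_trans (pointwise kl) _; apply: ler_wpM2l; first exact: powR_ge0.
  have pbp : (0 <= pb / p)%R by rewrite divr_ge0 ?(ltW p0) // (ltW (lt_trans ltr01 pb1)).
  apply: (ge0_ler_powR pbp); rewrite ?nnegrE //.
  exact: le_finite_max.
apply: (@le_trans _ _ ((A `^ (p * pb))%:E *
    \int[mu]_z (finite_max l c U z `^ pb * 1)%:E)).
  rewrite -ge0_integralZl_EFin ?powR_ge0 //.
  - apply: ge0_le_integral_nonmeasurable => z *.
    + by rewrite lee_fin powR_ge0.
    + by rewrite lee_fin !mulr_ge0 ?powR_ge0.
    + by rewrite -EFinM lee_fin.
  - by move=> z _; rewrite lee_fin mulr1 powR_ge0.
  - apply/measurable_EFinP; apply: measurable_funM => //.
    exact: measurableT_comp (measurable_powR _) (measurable_finite_max _ _ mU).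
have st := @finite_max_strong_type R K _ T _ Z lam mu Q U V v h (cst 1%R) B pb _
  mQ mU Q0 mv mh (measurable_cst _) v0 h0 (fun=> ler01) B0 pb1 V0 QV _ hN _ lam_l.
apply: (@le_trans _ _ ((A `^ (p * pb))%:E * (B * (maximal_const pb *
    \prod_(i < m) (maximal_const (P i) * N i) `^ (p / P i)))%:E)).
  apply: lee_wpmul2l; first by rewrite lee_fin powR_ge0.
  apply: st => k; rewrite (_ : \int[mu]_(z in U k) _ = mu (U k)) //.
  by rewrite -[RHS]mul1e -integral_cst.
rewrite -EFinM lee_fin le_eqVlt; apply/orP; left; apply/eqP.
rewrite /multilinear_const.
under eq_bigr do rewrite powRM ?mc0 //.
rewrite big_split /=; ring.
Qed.

End multilinear_laminar.

(** * From dyadic families to all cubes *)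

Section limn_einf_bounds.
Context {R : realType}.
Implicit Types (u : (\bar R)^nat) (x : \bar R).

Lemma limn_einf_ge u x N0 : (forall N, (N0 <= N)%N -> x <= u N) -> x <= limn_einf u.
Proof.
move=> xu; rewrite limn_einf_lim (cvg_lim _ (@cvg_einfs_sup _ u)) //.
apply: le_trans (ereal_sup_ubound _); last by exists N0.
by apply: le_ereal_inf_tmp => _ [N /= N0N <-]; exact: xu.
Qed.

Lemma limn_einf_le u x : (forall N, u N <= x) -> limn_einf u <= x.
Proof.
move=> ux; rewrite limn_einf_lim (cvg_lim _ (@cvg_einfs_sup _ u)) //.
apply: ge_ereal_sup => _ [N _ <-]; apply: le_trans (ux N).
by apply: ereal_inf_lbound; exists N => /=.
Qed.

End limn_einf_bounds.

(** * The estimate for positive Borel weights *)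

Section borel_bound.
Context {R : realType} {m n : nat}.
Variables (mu : {measure set (n.-tuple R * R) -> \bar R}).
Variables (p pb A B : R) (P : 'I_m -> R) (w f : 'I_m -> n.-tuple R -> R) (N : 'I_m -> R).
Local Notation q i := (conjugate (P i)).
Local Notation sigma i := (fun x => w i x `^ (1 - q i))%R.
Local Notation v := (v_weight p P w).
Local Notation lebRn := lebesgue_measure_Rn.
Local Notation volume Q := ((side Q)%:num ^+ n)%R.
Local Notation mean Q g := (fine (\int[lebRn]_(x in cube_set Q) (g x)%:E) / volume Q)%R.

Hypotheses (m0 : (0 < m)%N) (p0 : (0 < p)%R) (P1 : forall i, (1 < P i)%R).
Hypothesis (pE : (p^-1 = \sum_(i < m) (P i)^-1)%R).
Hypotheses (pb1 : (1 < pb)%R) (qpb : forall i, (q i <= pb)%R).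
Hypotheses (A0 : (0 <= A)%R) (B0 : (0 <= B)%R).
Hypotheses (mw : forall i, measurable_fun [set: n.-tuple R] (w i)).
Hypotheses (mf : forall i, measurable_fun [set: n.-tuple R] (f i)).
Hypotheses (w0 : forall i x, (0 < w i x)%R) (f0 : forall i x, (0 <= f i x)%R).
Hypothesis v_fin : forall Q : cube R n, \int[lebRn]_(x in cube_set Q) (v x)%:E < +oo.
Hypothesis sigma_fin : forall (Q : cube R n) i, \int[lebRn]_(x in cube_set Q) (sigma i x)%:E < +oo.
Hypothesis AP : forall Q : cube R n,
  (mean Q v `^ p^-1 * \prod_(i < m) mean Q (sigma i) `^ (q i)^-1 <= A)%R.
Hypothesis UV : forall Q : cube R n,
  mu (tent Q) <= B%:E * \int[lebRn]_(x in cube_set Q) (v x)%:E.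
Hypothesis fN : forall i, \int[lebRn]_x (f i x `^ P i * w i x)%:E <= (N i)%:E.

Let bound := (multilinear_const p pb P * B * A `^ (p * pb) * \prod_(i < m) N i `^ (p / P i))%R.

Let mpow (g : n.-tuple R -> R) r : measurable_fun [set: n.-tuple R] g ->
  measurable_fun [set: n.-tuple R] (fun x => g x `^ r)%R.
Proof. exact: measurableT_comp (measurable_powR _). Qed.

Let mv : measurable_fun [set: n.-tuple R] v.
Proof. by apply: measurable_prod => i _; exact: mpow. Qed.

Let v0 x : (0 < v x)%R.
Proof. by apply: prodr_gt0 => i _; exact: powR_gt0. Qed.

Section one_grid.
Variables (L : nat) (a : {ffun 'I_n -> bool}).
Let Q := grid_cube (R := R) L a.
Let Vol (k : @grid_index n) : R := (grid_side L k ^+ n)%R.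
Let V k := fine (\int[lebRn]_(x in Q k) (v x)%:E).
Let S i k := fine (\int[lebRn]_(x in Q k) (sigma i x)%:E).

Let Vol0 k : (0 < Vol k)%R.
Proof. by rewrite exprn_gt0 // grid_side_gt0. Qed.

Let fin_gt0 (g : n.-tuple R -> R) k : measurable_fun [set: n.-tuple R] g ->
  (forall x, (0 < g x)%R) ->
  \int[lebRn]_(x in cube_set (grid_closure L a k)) (g x)%:E < +oo ->
  \int[lebRn]_(x in Q k) (g x)%:E = (fine (\int[lebRn]_(x in Q k) (g x)%:E))%:E /\
  (0 < fine (\int[lebRn]_(x in Q k) (g x)%:E))%R.
Proof.
move=> mg g0; rewrite (@integral_grid_closure R n L a k g mg (fun x => ltW (g0 x))) => gfin.
have I0 : 0 < \int[lebRn]_(x in Q k) (g x)%:E.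
  apply: integral_gt0 => //; first exact: measurable_grid_cube.
  - by rewrite [ltRHS](lebesgue_grid_cube L a k) lte_fin; exact: Vol0.
  - exact: measurable_funTS.
split; last by apply: fine_gt0; rewrite I0.
by rewrite fineK // ge0_fin_numE // ltW.
Qed.

Let QV k : \int[lebRn]_(x in Q k) (v x)%:E = (V k)%:E.
Proof. by have [] := fin_gt0 mv v0 (v_fin (grid_closure L a k)). Qed.
Let V0 k : (0 < V k)%R.
Proof. by have [] := fin_gt0 mv v0 (v_fin (grid_closure L a k)). Qed.

Let sigma0 i x : (0 < sigma i x)%R. Proof. exact: powR_gt0. Qed.
Let msigma i : measurable_fun [set: n.-tuple R] (sigma i). Proof. exact: mpow. Qed.

Let QS i k : \int[lebRn]_(x in Q k) (sigma i x)%:E = (S i k)%:E.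
Proof. by have [] := fin_gt0 (msigma i) (sigma0 i) (sigma_fin (grid_closure L a k) i). Qed.
Let S0 i k : (0 < S i k)%R.
Proof. by have [] := fin_gt0 (msigma i) (sigma0 i) (sigma_fin (grid_closure L a k) i). Qed.

Let APk k : ((V k / Vol k) `^ p^-1 * \prod_(i < m) (S i k / Vol k) `^ (q i)^-1 <= A)%R.
Proof.
have VE : fine (\int[lebRn]_(x in cube_set (grid_closure L a k)) (v x)%:E) = V k.
  by rewrite (@integral_grid_closure R n L a k v mv (fun x => ltW (v0 x))).
have SE i : fine (\int[lebRn]_(x in cube_set (grid_closure L a k)) (sigma i x)%:E) = S i k.
  by rewrite (@integral_grid_closure R n L a k _ (msigma i) (fun x => ltW (sigma0 i x))).
have volE : ((side (grid_closure L a k))%:num ^+ n)%R = Vol k by [].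
have -> : (\prod_(i < m) (S i k / Vol k) `^ (q i)^-1 =
    \prod_(i < m) mean (grid_closure L a k) (sigma i) `^ (q i)^-1)%R.
  by apply: eq_bigr => i _; rewrite SE volE.
rewrite -VE -volE; exact: AP.
Qed.

Let UVk k : mu (grid_tent L a k) <= (B * V k)%:E.
Proof.
rewrite EFinM -QV -(@integral_grid_closure R n L a k v mv (fun x => ltW (v0 x))).
apply: le_trans (UV _); apply: le_measure; rewrite ?inE.
- exact: measurable_grid_tent.
- exact: measurable_tent.
- exact: grid_tent_closure.
Qed.

Definition grid_max (z : n.-tuple R * R) : R :=
  finite_max (grid_list L) (laminar_average lebRn Q f Vol) (grid_tent L a) z.

Lemma grid_integral_fin i k : \int[lebRn]_(x in Q k) (f i x)%:E \is a fin_num.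
Proof.
apply: (laminar_integral_fin (P := P) (w := w) (S := S) (N := N)) => // k'.
exact: measurable_grid_cube.
Qed.

Lemma grid_max_bound : \int[mu]_z (grid_max z `^ p)%:E <= bound%:E.
Proof.
apply: (multilinear_laminar_bound (V := V) (S := S) (w := w)) => //.
- by move=> k; exact: measurable_grid_cube.
- by move=> k; exact: measurable_grid_tent.
- by move=> k; exact: lebesgue_grid_cube.
- exact: laminar_grid_list.
Qed.

Lemma measurable_grid_max : measurable_fun setT grid_max.
Proof. by apply: measurable_finite_max => k; exact: measurable_grid_tent. Qed.

End one_grid.

(** Enlarging [Q] to a grid cube of side at most six times as long costs [6 ^ n] per average. The
    threshold [N0] depends on [Q], and the shift [a] may vary with [L]. *)
Lemma product_average_le_grid_max (Q : cube R n) (z : n.-tuple R * R) :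
  cube_set Q z.1 -> (0 <= z.2 <= (side Q)%:num)%R ->
  exists N0, forall L, (N0 <= L)%N -> exists a,
    \prod_(i < m) average Q (fun y => (f i y)%:E) <=
    ((6 ^+ n) ^+ m * grid_max L a z)%:E.
Proof.
move=> Qz /andP[z0 zQ]; have [N0 cover] := grid_list_cover Q.
exists N0 => L /cover[a [k [kL QQ Qs sQ]]]; exists a.
have d0 : (0 < (side Q)%:num)%R by [].
have s0 := @grid_side_gt0 R n L k.
pose I i := fine (\int[lebRn]_(x in grid_cube L a k) (f i x)%:E).
pose J i := fine (\int[lebRn]_(x in cube_set Q) (f i x)%:E).
have mQ := measurable_cube_set Q; have mG := measurable_grid_cube (R := R) L a k.
have IE i : \int[lebRn]_(x in grid_cube L a k) (f i x)%:E = (I i)%:E.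
  by rewrite fineK // grid_integral_fin.
have JI_ereal i : \int[lebRn]_(x in cube_set Q) (f i x)%:E <= (I i)%:E.
  rewrite -IE; apply: ge0_subset_integral => //.
  - by apply/measurable_EFinP; exact: measurable_funTS.
  - by move=> x _; rewrite lee_fin.
have J_ge0 i : 0 <= \int[lebRn]_(x in cube_set Q) (f i x)%:E.
  by apply: integral_ge0 => x _; rewrite lee_fin.
have JE i : \int[lebRn]_(x in cube_set Q) (f i x)%:E = (J i)%:E.
  by rewrite fineK // ge0_fin_numE // (le_lt_trans (JI_ereal i)) // ltry.
have J0 i : (0 <= J i)%R by rewrite -lee_fin -JE.
have JI i : (J i <= I i)%R by rewrite -lee_fin -JE.
have vQ : (0 < volume Q)%R by rewrite exprn_gt0.
have vk : (0 < (grid_side L k : R) ^+ n)%R by rewrite exprn_gt0.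
have avgE i : average Q (fun y => (f i y)%:E) = (J i / volume Q)%:E.
  by rewrite /average JE [X in _ / X](lebesgue_cube_set Q) inver gt_eqF.
under eq_bigr do rewrite avgE.
rewrite prodEFin lee_fin.
apply: (@le_trans _ _ ((6 ^+ n) ^+ m * \prod_(i < m) (I i / grid_side L k ^+ n))%R).
  rewrite -[in X in (_ <= X * _)%R](card_ord m) -prodr_const -big_split /=.
  apply: ler_prod => i _; rewrite divr_ge0 ?(ltW vQ) //=.
  rewrite ler_pdivrMr // (le_trans (JI i)) //.
  have -> : (6 ^+ n * (I i / grid_side L k ^+ n) * volume Q =
      I i * ((6 * (side Q)%:num) ^+ n / grid_side L k ^+ n))%R.
    have ringE (x y z' t : R) : (x * (y * z') * t = y * (x * t * z'))%R by ring.
    by rewrite [((6 * _) ^+ n)%R]exprMn ringE.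
  rewrite ler_peMr ?(le_trans (J0 i)) // ler_pdivlMr // mul1r.
  by apply: lerXn2r; rewrite ?nnegrE ?(ltW s0) // mulr_ge0 // ltW.
apply: ler_wpM2l; first by rewrite !exprn_ge0.
apply: le_finite_max kL _; split; first exact: QQ.
by rewrite z0 /= (le_lt_trans zQ) // (le_lt_trans _ Qs) // ler_peMl // ?ler1n // ltW.
Qed.

(** The sum over all shifts dominates whichever shift suits a given cube. *)
Let majorant L (z : n.-tuple R * R) : R :=
  (\sum_(a : {ffun 'I_n -> bool}) ((6 ^+ n) ^+ m) `^ p * grid_max L a z `^ p)%R.

Let majorant_ge0 L z : (0 <= majorant L z)%R.
Proof. by apply: sumr_ge0 => a _; rewrite mulr_ge0 ?powR_ge0. Qed.

Let mgrid_max L a : measurable_fun setT (fun z => grid_max L a z `^ p)%R.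
Proof. exact: measurableT_comp (measurable_powR _) (measurable_grid_max L a). Qed.

Let mmajorant L : measurable_fun setT (majorant L).
Proof. by apply: measurable_sum => a; exact: measurable_funM. Qed.

Lemma average_ge0 (Q : cube R n) (g : n.-tuple R -> \bar R) :
  (forall x, 0 <= g x) -> 0 <= average Q g.
Proof.
move=> g0; rewrite /average; apply: mule_ge0; first by apply: integral_ge0.
by rewrite inve_ge0.
Qed.

(** Each single cube is controlled by the majorant for all large [L], hence by the lower limit; only
    then is the supremum over cubes taken. *)
Lemma maximal_power_le z : upper_half_space z ->
  poweR `|multilinear_maximal f z| p <= limn_einf (fun L => (majorant L z)%:E).
Proof.
move=> z0; set l := limn_einf _.
have l0 : 0 <= l by apply: (limn_einf_ge (N0 := 0)) => L _; rewrite lee_fin.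
have absf i : (fun y => `|f i y|%:E) = (fun y => (f i y)%:E).
  by apply/funext => y; rewrite ger0_norm.
have in0y (x : \bar R) : 0 <= x -> x \in `[0, +oo].
  by move=> x0; rewrite in_itv /= x0 leey.
have p_neq0 : p != 0%R by rewrite gt_eqF.
have powK (x : \bar R) : 0 <= x -> x = poweR (poweR x p) p^-1%R.
  by move=> x0; rewrite -poweRrM divff // poweRe1.
have prod0 (Q : cube R n) : 0 <= \prod_(i < m) average Q (fun y => `|f i y|%:E).
  by apply: prode_ge0 => i _; apply: average_ge0 => x; rewrite lee_fin.
have M_ge0 : 0 <= multilinear_maximal f z.
  (* An admissible cube is exhibited because the supremum of an empty set would be [-oo]. *)
  pose s := Num.max 1%R z.2; have s0 : (0 < s)%R by rewrite lt_max ltr01.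
  pose Q := Cube z.1 (PosNum s0).
  apply: le_trans (prod0 Q) _; apply: ereal_sup_ubound; exists Q => //; split => /=.
    by move=> i; rewrite lexx lerDl ltW.
  by rewrite le_max lexx orbT.
have Ml : multilinear_maximal f z <= poweR l p^-1%R.
  apply: ge_ereal_sup => _ [Q [Qz zQ] <-].
  have [|N0 gm] := @product_average_le_grid_max Q z Qz; first by rewrite zQ andbT.
  rewrite [leLHS](powK _ (prod0 Q)).
  apply: gt0_ler_poweR; rewrite ?in0y ?poweR_ge0 ?invr_ge0 ?(ltW p0) //.
  apply: (limn_einf_ge (N0 := N0)) => L /gm[a]; under eq_bigr do rewrite -absf.
  move=> avg_le; apply: (@le_trans _ _ (((6 ^+ n) ^+ m * grid_max L a z)%:E `^ p)).
    by apply: gt0_ler_poweR (avg_le); rewrite ?(ltW p0) // in0y // (le_trans _ avg_le).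
  rewrite poweR_EFin lee_fin powRM ?exprn_ge0 ?finite_max_ge0 //.
  rewrite /majorant (bigD1 a) //= lerDl; apply: sumr_ge0 => b _.
  by rewrite mulr_ge0 ?powR_ge0.
rewrite gee0_abs // [leRHS](powK _ l0) poweRAC.
by apply: gt0_ler_poweR; rewrite ?in0y ?poweR_ge0 ?(ltW p0).
Qed.

Lemma half_space_integral_le :
  \int[mu]_(z in upper_half_space) poweR `|multilinear_maximal f z| p <=
  (#|{ffun 'I_n -> bool}|%:R * ((6 ^+ n) ^+ m) `^ p * bound)%:E.
Proof.
have mD : measurable (@upper_half_space R n).
  rewrite (_ : upper_half_space = setT `*` `[0%R, +oo[%classic).
    by apply: measurableX => //; exact: measurable_itv.
  by apply/seteqP; split => z /=; rewrite in_itv /= andbT // => -[].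
apply: (@le_trans _ _ (\int[mu]_(z in upper_half_space) limn_einf (fun L => (majorant L z)%:E))).
  apply: ge0_le_integral_nonmeasurable => z.
  - exact: poweR_ge0.
  - by apply: (limn_einf_ge (N0 := 0)) => L _; rewrite lee_fin.
  - exact: maximal_power_le.
apply: le_trans (fatou mu mD _ _) _.
- by move=> L; apply/measurable_EFinP; exact: measurable_funTS.
- by move=> L z _; rewrite lee_fin.
apply: limn_einf_le => L.
apply: (@le_trans _ _ (\int[mu]_z (majorant L z)%:E)).
  apply: ge0_subset_integral => //; first exact/measurable_EFinP.
  by move=> z _; rewrite lee_fin.
rewrite /majorant; under eq_integral do rewrite -sumEFin.
rewrite ge0_integral_sum //; last 2 first.
- by move=> a; apply/measurable_EFinP; exact: measurable_funM.
- by move=> a z _; rewrite lee_fin mulr_ge0 ?powR_ge0.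
apply: (@le_trans _ _ (\sum_(a : {ffun 'I_n -> bool}) (((6 ^+ n) ^+ m) `^ p * bound)%:E)).
  apply: lee_sum => a _; under eq_integral do rewrite EFinM.
  rewrite ge0_integralZl_EFin ?powR_ge0 //; last 2 first.
  - by move=> z _; rewrite lee_fin powR_ge0.
  - exact/measurable_EFinP.
  by rewrite EFinM lee_wpmul2l // ?lee_fin ?powR_ge0 // grid_max_bound.
by rewrite sumEFin sumr_const lee_fin -mulrA -[leLHS]mulr_natl; exact: lexx.
Qed.

End borel_bound.

(** * Reduction to positive Borel weights *)

Section exhaustion.
Context {R : realType} {n : nat}.

(** The cube [[- (k + 1), k + 1] ^ n]; these cubes exhaust the space. *)
Definition centered_cube (k : nat) : cube R n :=
  Cube [tuple (- k.+1%:R)%R | i < n] (PosNum (ltr0Sn R (2 * k).+1)).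

Lemma centered_cubeP k x :
  cube_set (centered_cube k) x <-> forall i, (`|tnth x i| <= k.+1%:R)%R.
Proof.
have E : ((2 * k).+2%:R = k.+1%:R + k.+1%:R :> R)%R by rewrite -natrD; congr (_%:R)%R; lia.
split => H i; have := H i; rewrite /= tnth_mktuple ler_norml => /andP[x1 x2].
  by rewrite x1; move: x2; rewrite E addKr.
by rewrite x1 E addKr.
Qed.

Lemma cube_sub_centered (Q : cube R n) :
  exists k0, forall k, (k0 <= k)%N -> cube_set Q `<=` cube_set (centered_cube k).
Proof.
pose M := ((side Q)%:num + \sum_i `|tnth (corner Q) i|)%R.
exists (Num.truncn M) => k Mk x Qx; apply/centered_cubeP => i.
have {}Mk : (M <= k.+1%:R)%R.
  by apply: (le_trans (ltW (Num.Theory.truncnS_gt M))); rewrite ler_nat.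
have ci : (`|tnth (corner Q) i| <= \sum_i `|tnth (corner Q) i|)%R.
  by rewrite (bigD1 i) //= lerDl sumr_ge0.
have d0 : (0 < (side Q)%:num)%R by [].
apply: le_trans Mk; rewrite /M; have /andP[] := Qx i.
move: ci; rewrite ler_norml => /andP[c1 c2] x1 x2; rewrite ler_norml.
by move: c1 c2 x1 x2 d0; set s := (side Q)%:num%R; move=> *; lra.
Qed.

Lemma point_sub_centered (x : n.-tuple R) :
  exists k0, forall k, (k0 <= k)%N -> cube_set (centered_cube k) x.
Proof.
have [k0 H] := cube_sub_centered (Cube x (PosNum (@ltr01 R))).
by exists k0 => k /H; apply => i; rewrite /= lexx lerDl ler01.
Qed.

Lemma upper_half_space_negligible (mu : {measure set (n.-tuple R * R) -> \bar R}) :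
  (forall Q : cube R n, mu (tent Q) = 0) -> mu.-negligible upper_half_space.
Proof.
move=> mu0.
have cover : (@upper_half_space R n) `<=` \bigcup_k tent (centered_cube k).
  move=> z z0; have [k0 zk] := point_sub_centered z.1.
  exists (maxn k0 (Num.truncn z.2)) => //; split; first by apply: zk; rewrite leq_maxl.
  rewrite z0 /=; apply: (lt_le_trans (Num.Theory.truncnS_gt z.2)).
  rewrite /= ler_nat; move: (Num.truncn _) => t. lia.
apply: negligibleS cover _; apply: negligible_bigcup => k.
by apply/negligibleP; [exact: measurable_tent|exact: mu0].
Qed.

End exhaustion.

(** * Positive Borel versions of the weights *)

Section borel_versions.
Context {R : realType} {n : nat}.
Local Notation lebRn := lebesgue_measure_Rn.
Implicit Types (u W : n.-tuple R -> R).

Lemma powRy_ge0 (x r : R) : 0 <= powRy x r.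
Proof. by rewrite /powRy; case: ifP => // _; rewrite lee_fin powR_ge0. Qed.

Lemma powRy_gt0 (x r : R) : (0 < x)%R -> powRy x r = (x `^ r)%:E.
Proof. by move=> x0; rewrite /powRy gt_eqF. Qed.

Lemma nonneg_borel_version u : (forall x, 0 <= u x)%R -> lebesgue_measurable u ->
  exists W, [/\ measurable_fun [set: n.-tuple R] W, forall x, (0 <= W x)%R &
    {ae lebRn, forall x, u x = W x}].
Proof.
move=> u0 [W mW uW]; exists (fun x => Num.max (W x) 0%R); split.
- exact: measurable_maxr.
- by move=> x; rewrite le_max lexx orbT.
- by apply: filterS uW => x ux; rewrite -ux max_l.
Qed.

(** The value 0 is changed to 1. *)
Let posify W x := (W x + \1_(W @^-1` [set 0%R]) x)%R.

Let measurable_zero W : measurable_fun [set: n.-tuple R] W ->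
  measurable (W @^-1` [set 0%R]).
Proof. by move=> mW; rewrite -[X in measurable X]setTI; exact: mW. Qed.

Let measurable_posify W : measurable_fun [set: n.-tuple R] W ->
  measurable_fun [set: n.-tuple R] (posify W).
Proof.
by move=> mW; apply: measurable_funD => //; apply: measurable_indic; exact: measurable_zero.
Qed.

Let posify_gt0 W x : (forall x, 0 <= W x)%R -> (0 < posify W x)%R.
Proof.
move=> W0; rewrite /posify indicE; have [Wx|Wx] := eqVneq (W x) 0%R.
  by rewrite Wx mem_set // add0r.
by rewrite memNset ?addr0 ?lt_neqAle 1?eq_sym ?Wx ?W0 // => /eqP; exact/negP.
Qed.

Lemma cube_set_gt0 (Q : cube R n) : 0 < lebRn (cube_set Q).
Proof. by rewrite [ltRHS](lebesgue_cube_set Q) lte_fin exprn_gt0. Qed.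

Lemma integral_powRy_gt0 u r (Q : cube R n) : (forall x, 0 <= u x)%R ->
  lebesgue_measurable u -> (r < 0)%R -> 0 < \int[lebRn]_(x in cube_set Q) powRy (u x) r.
Proof.
move=> u0 /(nonneg_borel_version u0)[W [mW W0 uW]] r0.
apply: (@lt_le_trans _ _ (\int[lebRn]_(x in cube_set Q) (posify W x `^ r)%:E)).
  apply: integral_gt0; first exact: measurable_cube_set.
  - exact: cube_set_gt0.
  - apply: measurable_funTS; apply: measurableT_comp (measurable_powR _) _.
    exact: measurable_posify.
  - by move=> x; rewrite powR_gt0 // posify_gt0.
apply: ae_ge0_le_integral => [x|x|]; [by rewrite lee_fin powR_ge0|exact: powRy_ge0|].
apply: filterS uW => x ux _; rewrite ux /powRy r0 andbT; case: ifPn => Wx; first exact: leey.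
rewrite lee_fin /posify indicE memNset ?addr0 // => /eqP; exact/negP.
Qed.

(** For [r < 0] the power is [+oo] where [u] vanishes. Finite integrals over an exhausting sequence
    of cubes therefore make the zero set null, and [u] may be altered there. *)
Lemma positive_borel_version u r : (forall x, 0 <= u x)%R -> lebesgue_measurable u ->
  (r < 0)%R ->
  (exists k0, forall k, (k0 <= k)%N ->
    \int[lebRn]_(x in cube_set (centered_cube k)) powRy (u x) r < +oo) ->
  exists W, [/\ measurable_fun [set: n.-tuple R] W, forall x, (0 < W x)%R &
    {ae lebRn, forall x, u x = W x}].
Proof.
move=> u0 /(nonneg_borel_version u0)[W [mW W0 uW]] r0 [k0 fin].
exists (posify W); split; [exact: measurable_posify|by move=> x; exact: posify_gt0|].
pose E := W @^-1` [set 0%R].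
have mE : measurable E by exact: measurable_zero.
suff E0 : lebRn.-negligible E.
  have nE : {ae lebRn, forall x, ~ E x}.
    by apply: negligibleS E0 => x /= /contrapT.
  apply: filterS2 uW nE => x -> Ex.
  by rewrite /posify indicE memNset // addr0.
have cover : E `<=` \bigcup_k (cube_set (centered_cube (k0 + k)) `&` E).
  move=> x Ex; have [k1 xk] := point_sub_centered x.
  by exists k1 => //; split => //; apply: xk; rewrite leq_addl.
apply: negligibleS cover _; apply: negligible_bigcup => k.
have mQ := measurable_cube_set (centered_cube (n := n) (R := R) (k0 + k)).
apply/negligibleP; first exact: measurableI.
apply/eqP; rewrite eq_le measure_ge0 andbT leNgt; apply/negP => QE.
have := fin _ (leq_addr k k0); apply/negP; rewrite -leNgt.
apply: (@le_trans _ _ (\int[lebRn]_(x in cube_set (centered_cube (k0 + k))) ((cst +oo) \_ E) x)).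
  rewrite -integral_mkcondr integral_cst; last exact: measurableI.
  by rewrite gt0_mulye.
apply: ae_ge0_le_integral => [x|x|]; [by rewrite /patch; case: ifP => _; rewrite /= ?leey|exact: powRy_ge0|].
apply: filterS uW => x ux _; rewrite ux /patch; case: ifPn; last by move=> _; exact: powRy_ge0.
by rewrite inE => Wx; rewrite /powRy Wx eqxx r0.
Qed.

End borel_versions.

Section constants.
Context {R : realType}.

Lemma maximal_const_gt0 (r : R) : (1 < r)%R -> (0 < maximal_const r)%R.
Proof.
by move=> r1; rewrite mulr_gt0 // powR_gt0 // mulr_gt0 // divr_gt0 //; lra.
Qed.

(** Positivity of all factors rules out the convention [0 * +oo = 0]. *)
Lemma prode_lty (m : nat) (x : \bar R) (y : 'I_m -> \bar R) :
  0 < x -> (forall i, 0 < y i) -> x * \prod_(i < m) y i < +oo ->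
  x < +oo /\ forall i, y i < +oo.
Proof.
move=> x0 y0 xy; have Y0 (C : pred 'I_m) : 0 < \prod_(i < m | C i) y i.
  by apply: (big_ind (fun z => 0 < z)) => [|z t|i _]; [exact: lte01|exact: mule_gt0|exact: y0].
split=> [|i]; rewrite ltey; apply/eqP => E.
  by move: xy; rewrite E gt0_mulye ?ltxx //; exact: (Y0 xpredT).
by move: xy; rewrite (bigD1 i) //= E gt0_mulye // gt0_muley // ltxx.
Qed.

End constants.

(** * General weights and assembly of the constant *)

Section reduction.
Context {R : realType} {m n : nat}.
Variables (P : 'I_m -> R) (p : R).
Hypotheses (m0 : (0 < m)%N) (P1 : forall i, (1 < P i)%R).
Hypothesis pE : (p^-1 = \sum_(i < m) (P i)^-1)%R.
Local Notation q i := (conjugate (P i)).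
Local Notation lebRn := lebesgue_measure_Rn.
Local Notation pb := (\big[Num.max/0%R]_(i < m) conjugate (P i)).

Lemma exponent_gt0 : (0 < p)%R.
Proof.
rewrite -invr_gt0 pE (bigD1 (Ordinal m0)) //= ltr_wpDr //.
  by apply: sumr_ge0 => i _; rewrite invr_ge0 ltW // (lt_trans ltr01).
by rewrite invr_gt0 (lt_trans ltr01).
Qed.

Lemma conjugate_le_max i : (q i <= pb)%R.
Proof. exact: le_bigmax. Qed.

Lemma max_conjugate_gt1 : (1 < pb)%R.
Proof. exact: lt_le_trans (conjugate_gt1 (P1 (Ordinal m0))) (conjugate_le_max _). Qed.

Variables (mu : {measure set (n.-tuple R * R) -> \bar R}) (w : 'I_m -> n.-tuple R -> R).
Hypothesis ww : forall i, weight (w i).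
Hypothesis A_fin : A_constant p P w < +oo.
Hypothesis C_fin : C_infty_constant mu (v_weight p P w) < +oo.

Let v := v_weight p P w.

Let w0 i x : (0 <= w i x)%R. Proof. by have [] := ww i. Qed.
Let lw i : lebesgue_measurable (w i). Proof. by have [] := ww i. Qed.
Let v0 x : (0 <= v x)%R. Proof. by apply: prodr_ge0 => i _; exact: powR_ge0. Qed.
Let r0 i : (1 - q i < 0)%R. Proof. by rewrite subr_lt0 conjugate_gt1. Qed.

Let A_elt (Q : cube R n) :=
  poweR (average Q (fun x => (v x)%:E)) p^-1%R *
  \prod_(i < m) poweR (average Q (fun x => powRy (w i x) (1 - q i)%R)) (q i)^-1%R.

Let A_ge (Q : cube R n) : A_elt Q <= A_constant p P w.
Proof. by apply: ereal_sup_ubound; exists Q. Qed.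

Let averageE (Q : cube R n) (g : n.-tuple R -> \bar R) :
  average Q g = (\int[lebRn]_(x in cube_set Q) g x) * (((side Q)%:num ^+ n)^-1)%:E.
Proof. by rewrite /average [X in _ / X](lebesgue_cube_set Q) inver gt_eqF // exprn_gt0. Qed.

Let vol_gt0 (Q : cube R n) : (0 < ((side Q)%:num ^+ n)^-1 :> R)%R.
Proof. by rewrite invr_gt0 exprn_gt0. Qed.

Let average_gt0 (Q : cube R n) (g : n.-tuple R -> \bar R) :
  0 < \int[lebRn]_(x in cube_set Q) g x -> 0 < average Q g.
Proof. by move=> g0; rewrite averageE mule_gt0 // lte_fin. Qed.

Let average_lty (Q : cube R n) (g : n.-tuple R -> \bar R) :
  average Q g < +oo -> \int[lebRn]_(x in cube_set Q) g x < +oo.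
Proof.
rewrite averageE !ltey; apply: contra_neq => ->.
by rewrite gt0_mulye // lte_fin.
Qed.

(** Positive [v]-mass makes every factor of the [A_P] expression positive, so a finite product
    forces finite factors. *)
Let integrals_lty (Q : cube R n) : 0 < \int[lebRn]_(x in cube_set Q) (v x)%:E ->
  \int[lebRn]_(x in cube_set Q) (v x)%:E < +oo /\
  forall i, \int[lebRn]_(x in cube_set Q) powRy (w i x) (1 - q i)%R < +oo.
Proof.
move=> vQ; have q0 i : (q i)^-1%R != 0%R.
  by rewrite invr_eq0 gt_eqF // (lt_trans ltr01) // conjugate_gt1.
have [|||vfin sfin] := @prode_lty R m (poweR (average Q (fun x => (v x)%:E)) p^-1%R)
  (fun i => poweR (average Q (fun x => powRy (w i x) (1 - q i)%R)) (q i)^-1%R).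
- exact/poweR_gt0/average_gt0.
- by move=> i; apply/poweR_gt0/average_gt0/integral_powRy_gt0.
- exact: le_lt_trans (A_ge Q) A_fin.
split=> [|i]; apply: average_lty.
  by apply: lty_poweRy vfin; rewrite invr_eq0 gt_eqF // exponent_gt0.
exact: lty_poweRy (sfin i).
Qed.

Let integral_sub (Q Q' : cube R n) (g : n.-tuple R -> \bar R) : (forall x, 0 <= g x) ->
  cube_set Q `<=` cube_set Q' ->
  \int[lebRn]_(x in cube_set Q) g x <= \int[lebRn]_(x in cube_set Q') g x.
Proof.
move=> g0 QQ; rewrite integral_mkcond [leRHS]integral_mkcond.
apply: ge0_le_integral_nonmeasurable => x *; rewrite /patch.
- by case: ifP.
- by case: ifP.
- case: ifPn; last by case: ifP.
  by rewrite inE => /QQ Qx; rewrite mem_set.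
Qed.

(** One cube of positive [v]-mass gives positive mass to all large centered cubes. Every cube lies
    in one of these, which transfers finiteness to it. *)
Lemma positive_weights (Q0 : cube R n) : 0 < \int[lebRn]_(x in cube_set Q0) (v x)%:E ->
  exists W : 'I_m -> n.-tuple R -> R,
    [/\ forall i, measurable_fun [set: n.-tuple R] (W i), forall i x, (0 < W i x)%R,
        forall i, {ae lebRn, forall x, w i x = W i x},
        forall Q : cube R n, \int[lebRn]_(x in cube_set Q) (v x)%:E < +oo &
        forall (Q : cube R n) i,
          \int[lebRn]_(x in cube_set Q) powRy (w i x) (1 - q i)%R < +oo].
Proof.
move=> vQ0; have [k0 Q0k] := cube_sub_centered Q0.
have vk k : (k0 <= k)%N -> 0 < \int[lebRn]_(x in cube_set (centered_cube k)) (v x)%:E.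
  move=> /Q0k QQ; apply: lt_le_trans vQ0 _; apply: integral_sub QQ => x.
  by rewrite lee_fin.
have /choice[W WP] i : exists W : n.-tuple R -> R,
    [/\ measurable_fun [set: n.-tuple R] W, forall x, (0 < W x)%R &
        {ae lebRn, forall x, w i x = W x}].
  apply: (@positive_borel_version R n (w i) (1 - q i)%R) => //; exists k0 => k /vk.
  by move=> /integrals_lty[_]; exact.
have large (Q : cube R n) : exists2 Q' : cube R n, cube_set Q `<=` cube_set Q' &
    0 < \int[lebRn]_(x in cube_set Q') (v x)%:E.
  have [k1 Qk] := cube_sub_centered Q; exists (centered_cube (maxn k0 k1)).
    by apply: Qk; rewrite leq_maxr.
  by apply: vk; rewrite leq_maxl.
exists W; split; try by move=> i; have [] := WP i.
- move=> Q; have [Q' QQ /integrals_lty[vfin _]] := large Q; apply: le_lt_trans vfin.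
  by apply: integral_sub QQ => x; rewrite lee_fin.
- move=> Q i; have [Q' QQ /integrals_lty[_ sfin]] := large Q; apply: le_lt_trans (sfin i).
  by apply: integral_sub QQ => x; exact: powRy_ge0.
Qed.

Variable f : 'I_m -> n.-tuple R -> R.
Hypothesis ff : forall i, weighted_Lspace (P i) (w i) (f i).

(** Its factors count the shifts, compare arbitrary cubes with grid cubes, and bound a finite
    family. *)
Definition half_space_const : R :=
  (#|{ffun 'I_n -> bool}|%:R * ((6 ^+ n) ^+ m) `^ p * multilinear_const p pb P)%R.

Lemma half_space_const_gt0 : (0 < half_space_const)%R.
Proof.
have card0 : (0 < #|{ffun 'I_n -> bool}|%:R :> R)%R.
  by rewrite ltr0n; apply/card_gt0P; exists [ffun=> false].
apply: mulr_gt0; first by apply: mulr_gt0 => //; rewrite powR_gt0 // !exprn_gt0.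
apply: mulr_gt0; first by apply: maximal_const_gt0; exact: max_conjugate_gt1.
by apply: prodr_gt0 => i _; apply: powR_gt0; exact: maximal_const_gt0.
Qed.

Lemma half_space_norm_le_null :
  (forall Q : cube R n, \int[lebRn]_(x in cube_set Q) (v x)%:E = 0) ->
  half_space_norm mu p (multilinear_maximal f) = 0.
Proof.
move=> vnull.
have tent0 (Q : cube R n) : mu (tent Q) = 0.
  apply/eqP; rewrite eq_le measure_ge0 andbT leNgt; apply/negP => tQ.
  have : mu (tent Q) * (\int[lebRn]_(x in cube_set Q) (v x)%:E)^-1 <=
      C_infty_constant mu v by apply: ereal_sup_ubound; exists Q.
  (* As [0^-1 = +oo], a tent of positive measure would make the [C_infty] constant infinite. *)
  by rewrite vnull inver eqxx gt0_muley // leye_eq => /eqP E; move: C_fin; rewrite E ltxx.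
rewrite /half_space_norm; suff -> : \int[mu]_(z in upper_half_space)
    poweR `|multilinear_maximal f z| p = 0.
  by rewrite poweR0r // invr_eq0 gt_eqF // exponent_gt0.
apply/eqP; rewrite eq_le integral_ge0 ?andbT; last by move=> z _; exact: poweR_ge0.
rewrite -(integral0 mu upper_half_space); apply: ae_ge0_le_integral => [z|//|].
  exact: poweR_ge0.
apply: negligibleS (upper_half_space_negligible tent0) => z /= H.
by apply: contrapT => zu; apply: H => /zu.
Qed.

Lemma half_space_norm_le (Q0 : cube R n) : 0 < \int[lebRn]_(x in cube_set Q0) (v x)%:E ->
  half_space_norm mu p (multilinear_maximal f) <=
    (half_space_const `^ p^-1)%:E * poweR (C_infty_constant mu v) p^-1%R
    * poweR (A_constant p P w) pb * \prod_(i < m) weighted_norm (P i) (w i) (f i).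
Proof.
move=> /positive_weights[W [mW W0 wW vfin sfin]].
have p0 := exponent_gt0.
have P0 i : (0 < P i)%R by exact: lt_trans (P1 i).
have /choice[F FP] i : exists F : n.-tuple R -> R,
    [/\ measurable_fun [set: n.-tuple R] F, forall x, (0 <= F x)%R &
        {ae lebRn, forall x, `|f i x|%R = F x}].
  have [[g mg fg] _] := ff i; exists (fun x => `|g x|%R); split.
  - exact: measurableT_comp mg.
  - by move=> x; rewrite normr_ge0.
  - by apply: filterS fg => x ->.
have mF i : measurable_fun [set: n.-tuple R] (F i) by have [] := FP i.
have F0 i x : (0 <= F i x)%R by have [] := FP i.
have fF i : {ae lebRn, forall x, `|f i x|%R = F i x} by have [] := FP i.
pose I i := \int[lebRn]_x ((`|f i x| `^ P i * w i x)%R%:E).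
have I0 i : 0 <= I i.
  by apply: integral_ge0 => x _; rewrite lee_fin mulr_ge0 ?powR_ge0.
have IE i : I i = (fine (I i))%:E.
  rewrite fineK // ge0_fin_numE //; have [_] := ff i.
  by rewrite /weighted_norm; apply: lty_poweRy; rewrite invr_eq0 gt_eqF.
have N0 i : (0 <= fine (I i))%R by exact: fine_ge0.
have vE (Q : cube R n) : \int[lebRn]_(x in cube_set Q) (v_weight p P W x)%:E =
    \int[lebRn]_(x in cube_set Q) (v x)%:E.
  apply: ae_ge0_eq_integral => [x|x|]; rewrite ?lee_fin //.
    by apply: prodr_ge0 => i _; exact: powR_ge0.
  have : {ae lebRn, forall x, forall i, w i x = W i x} by exact: filter_forall.
  by apply: filterS => x wx; rewrite /v /v_weight; under [in RHS]eq_bigr do rewrite wx.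
have sE (Q : cube R n) i : \int[lebRn]_(x in cube_set Q) (W i x `^ (1 - q i))%:E =
    \int[lebRn]_(x in cube_set Q) powRy (w i x) (1 - q i)%R.
  apply: ae_ge0_eq_integral => [x|x|]; [by rewrite lee_fin powR_ge0|exact: powRy_ge0|].
  by apply: filterS (wW i) => x ->; rewrite powRy_gt0.
have A0 : 0 <= A_constant p P w.
  apply: le_trans (A_ge Q0); apply: mule_ge0; first exact: poweR_ge0.
  by apply: prode_ge0 => i _; exact: poweR_ge0.
have C0 : 0 <= C_infty_constant mu v.
  have : mu (tent Q0) * (\int[lebRn]_(x in cube_set Q0) (v x)%:E)^-1 <=
      C_infty_constant mu v by apply: ereal_sup_ubound; exists Q0.
  apply: le_trans; apply: mule_ge0 => //; rewrite inve_ge0.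
  by apply: integral_ge0 => x _; rewrite lee_fin.
have [a aE] : exists a, A_constant p P w = a%:E.
  by exists (fine (A_constant p P w)); rewrite fineK // ge0_fin_numE.
have [b bE] : exists b, C_infty_constant mu v = b%:E.
  by exists (fine (C_infty_constant mu v)); rewrite fineK // ge0_fin_numE.
have a0 : (0 <= a)%R by rewrite -lee_fin -aE.
have b0 : (0 <= b)%R by rewrite -lee_fin -bE.
have mv : measurable_fun [set: n.-tuple R] (v_weight p P W).
  by apply: measurable_prod => i _; exact: measurableT_comp (measurable_powR _) (mW i).
have vW0 x : (0 < v_weight p P W x)%R by apply: prodr_gt0 => i _; exact: powR_gt0.
have v_gt0 (Q : cube R n) : 0 < \int[lebRn]_(x in cube_set Q) (v x)%:E.
  rewrite -vE; apply: integral_gt0 => //; first exact: measurable_cube_set.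
  - exact: cube_set_gt0.
  - exact: measurable_funTS.
have avgE (g : n.-tuple R -> R) (Q : cube R n) : (forall x, 0 <= g x)%R ->
    \int[lebRn]_(x in cube_set Q) (g x)%:E < +oo ->
    \int[lebRn]_(x in cube_set Q) (g x)%:E =
    (fine (\int[lebRn]_(x in cube_set Q) (g x)%:E))%:E.
  move=> g0 gfin; rewrite fineK // ge0_fin_numE //.
  by apply: integral_ge0 => x _; rewrite lee_fin.
have sfinW (Q : cube R n) i : \int[lebRn]_(x in cube_set Q) (W i x `^ (1 - q i))%:E < +oo.
  by rewrite sE.
have := @half_space_integral_le R m n mu p pb a b P W F (fun i => fine (I i)) m0 p0 P1 pE
  max_conjugate_gt1 conjugate_le_max a0 b0 mW mF W0 F0 _ sfinW.
move=> /(_ (fun Q => eq_ind_r (fun y => y < +oo) (vfin Q) (vE Q))).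
have AP (Q : cube R n) :
  ((fine (\int[lebRn]_(x in cube_set Q) (v_weight p P W x)%:E) / (side Q)%:num ^+ n) `^ p^-1 *
   \prod_(i < m) (fine (\int[lebRn]_(x in cube_set Q) (W i x `^ (1 - q i))%:E) /
     (side Q)%:num ^+ n) `^ (q i)^-1 <= a)%R.
  have vavg : average Q (fun x => (v x)%:E) =
      (fine (\int[lebRn]_(x in cube_set Q) (v_weight p P W x)%:E) / (side Q)%:num ^+ n)%:E.
    rewrite averageE -vE [in LHS]avgE ?vE //.
    by move=> x; exact: ltW.
  have savg i : average Q (fun x => powRy (w i x) (1 - q i)%R) =
      (fine (\int[lebRn]_(x in cube_set Q) (W i x `^ (1 - q i))%:E) / (side Q)%:num ^+ n)%:E.
    rewrite averageE -sE [in LHS]avgE //.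
    by move=> x; exact: powR_ge0.
  rewrite -lee_fin -aE; apply: le_trans (A_ge Q); rewrite EFinM -prodEFin /A_elt vavg poweR_EFin.
  rewrite le_eqVlt; apply/orP; left; apply/eqP; congr (_ * _).
  by apply: eq_bigr => i _; rewrite savg poweR_EFin.
move=> /(_ AP) {AP}.
have UV (Q : cube R n) : mu (tent Q) <=
    b%:E * \int[lebRn]_(x in cube_set Q) (v_weight p P W x)%:E.
  have : mu (tent Q) * (\int[lebRn]_(x in cube_set Q) (v x)%:E)^-1 <= b%:E.
    by rewrite -bE; apply: ereal_sup_ubound; exists Q.
  (* The [v]-mass of [Q] is positive and finite, so it can be multiplied across. *)
  rewrite vE [in X in X -> _]avgE // [in X in _ -> X]avgE //.
  have V0 : (0 < fine (\int[lebRn]_(x in cube_set Q) (v x)%:E))%R.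
    by apply: fine_gt0; rewrite v_gt0 vfin.
  by rewrite inver gt_eqF // lee_pdivrMr.
move=> /(_ UV) {UV}.
have FN i : \int[lebRn]_x (F i x `^ P i * W i x)%:E <= (fine (I i))%:E.
  rewrite -IE le_eqVlt; apply/orP; left; apply/eqP.
  apply: ae_ge0_eq_integral => [x|x|]; rewrite ?lee_fin ?mulr_ge0 ?powR_ge0 //.
    exact: ltW.
  by apply: filterS2 (wW i) (fF i) => x -> ->.
move=> /(_ FN) {FN} main.
(* The maximal function sees [f] only through integrals over cubes, so the two agree at every
   point. *)
have -> : multilinear_maximal f = multilinear_maximal F.
  apply/funext => z; rewrite /multilinear_maximal; congr ereal_sup.
  apply: eq_imagel => Q _; apply: eq_bigr => i _; rewrite /average; congr (_ / _).
  apply: ae_ge0_eq_integral => [x|x|]; rewrite ?lee_fin //.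
  by apply: filterS (fF i) => x ->; rewrite ger0_norm.
rewrite aE bE.
rewrite [X in _ <= _ * X](_ : _ = (\prod_(i < m) fine (I i) `^ (P i)^-1)%:E); last first.
  rewrite -prodEFin; apply: eq_bigr => i _.
  by rewrite /weighted_norm -/(I i) IE poweR_EFin.
rewrite !poweR_EFin -!EFinM /half_space_norm.
have in0y (x : \bar R) : 0 <= x -> x \in `[0, +oo].
  by move=> x0; rewrite in_itv /= x0 leey.
have int0 : 0 <= \int[mu]_(z in upper_half_space) poweR `|multilinear_maximal F z| p.
  by apply: integral_ge0 => z _; exact: poweR_ge0.
apply: le_trans (gt0_ler_poweR _ (in0y _ int0) (in0y _ (le_trans int0 main)) main) _.
  by rewrite invr_ge0 ltW.
rewrite poweR_EFin lee_fin le_eqVlt; apply/orP; left; apply/eqP.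
have prod0 : (0 <= \prod_(i < m) fine (I i) `^ (p / P i))%R.
  by apply: prodr_ge0 => i _; exact: powR_ge0.
have tc : (0 <= half_space_const)%R by exact/ltW/half_space_const_gt0.
transitivity ((half_space_const * b * a `^ (p * pb) *
    \prod_(i < m) fine (I i) `^ (p / P i)) `^ p^-1)%R.
  by congr (_ `^ _)%R; rewrite /half_space_const; ring.
have tcb : (0 <= half_space_const * b)%R by exact: mulr_ge0.
rewrite (powRM _ _ prod0) ?(mulr_ge0 tcb) ?powR_ge0 // (powRM _ tcb) ?powR_ge0 // (powRM _ tc b0).
rewrite -(powRrM a) (mulrAC p) divff ?gt_eqF // mul1r.
rewrite powR_prod; last by move=> i; exact: powR_ge0.
congr (_ * _)%R; apply: eq_bigr => i _.
by rewrite -powRrM mulrAC divff ?gt_eqF // mul1r.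
Qed.

End reduction.

Unset Implicit Arguments.

Theorem theorem1p3 (R : realType) (m n : nat) (hm : (1 <= m)%N) (hn : (1 <= n)%N)
    (P : 'I_m -> R) (hP : forall i : 'I_m, (1 < P i)%R)
    (p : R) (hp : (p^-1 = \sum_(i < m) (P i)^-1)%R) :
  exists c : R, (0 < c)%R /\
    forall (mu : {measure set (n.-tuple R * R) -> \bar R})
      (w : 'I_m -> n.-tuple R -> R),
      (forall i : 'I_m, weight (w i)) ->
      A_constant p P w < +oo ->
      C_infty_constant mu (v_weight p P w) < +oo ->
      forall f : 'I_m -> n.-tuple R -> R,
        (forall i : 'I_m, weighted_Lspace (P i) (w i) (f i)) ->
        half_space_norm mu p (multilinear_maximal f) <=
          c%:E
          * poweR (C_infty_constant mu (v_weight p P w)) p^-1%R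
          * poweR (A_constant p P w)
              (\big[Num.max/0%R]_(i < m) conjugate (P i))
          * \prod_(i < m) weighted_norm (P i) (w i) (f i).
Proof.
exists (half_space_const (n := n) P p `^ p^-1)%R; split.
  by rewrite powR_gt0 // half_space_const_gt0.
move=> mu w ww A_fin C_fin f ff.
(* If some cube has positive [v]-mass, the weights have positive Borel versions; otherwise the
   left-hand side is 0. *)
have [[Q0 vQ0]|vnull] := pselect (exists Q : cube R n,
    0 < \int[lebesgue_measure_Rn]_(x in cube_set Q) (v_weight p P w x)%:E).
  exact: half_space_norm_le vQ0.
rewrite (half_space_norm_le_null hm hP hp C_fin) //.
  rewrite !mule_ge0 ?lee_fin ?powR_ge0 ?poweR_ge0 //.
  by apply: prode_ge0 => i _; exact: poweR_ge0.
move=> Q; apply/eqP; rewrite eq_le integral_ge0 ?andbT; last first.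
  by move=> x _; rewrite lee_fin; apply: prodr_ge0 => i _; exact: powR_ge0.
by rewrite leNgt; apply/negP => vQ; apply: vnull; exists Q.
Qed.
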